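(* Let $(\mathcal T,\mathbf r)$ be a reduced T-mesh with a smoothness distribution constant along each maximal segment, and let $m,m'\ge0$ be integers. Let $(\mathcal T^{(1)},\mathbf r^{(1)}),(\mathcal T^{(2)},\mathbf r^{(2)})\in[\mathcal T,\mathbf r]_{\mathrm I}^{+}$. Then $$\chi\bigl(\mathcal Q_{m,m'}^{\mathbf r^{(1)}}((\mathcal T^{(1)})^\circ)\bigr)=\chi\bigl(\mathcal Q_{m,m'}^{\mathbf r^{(2)}}((\mathcal T^{(2)})^\circ)\bigr).$$
   Context: **T-meshes.** Coordinates on $\mathbb R^2$ are $(s,t)$, with $s$ horizontal and $t$ vertical. Let $\Omega\subset\mathbb R^2$ be a finite union of closed axis-aligned rectangles with pairwise disjoint interiors, with $\Omega$ simply connected and $\Omega^\circ$ connected. A T-mesh on $\Omega$ is a triple $\mathcal T=(\mathcal T_2,\mathcal T_1,\mathcal T_0)$: $\mathcal T_2$ is the finite set of these closed rectangles (cells); $\mathcal T_1=\mathcal T_1^h\cup\mathcal T_1^v$ is a finite set of closed horizontal and vertical segments (edges) contained in $\bigcup_{\sigma\in\mathcal T_2}\partial\sigma$; $\mathcal T_0$ is the set of endpoints of edges (vertices); each $\partial\sigma$ is a finite union of edges; distinct cells $\sigma,\sigma'$ satisfy $\sigma\cap\sigma'=\partial\sigma\cap\partial\sigma'$, a finite union of edges and vertices; distinct edges meet only in vertices. Interior edges $\mathcal T_1^\circ$ are the edges meeting $\Omega^\circ$; the other edges are boundary edges. Interior vertices $\mathcal T_0^\circ$ are the vertices in $\Omega^\circ$.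 (Different T-meshes may live on different domains $\Omega$.) **Maximal segments.** A segment is a connected union of edges lying on one straight line. $\operatorname{MS}(\mathcal T)$ is the set of maximal segments consisting of interior edges. Such a segment is a cross-cut if both endpoints lie on $\partial\Omega$, a ray if exactly one does, and a maximal interior segment (MIS) if it does not meet $\partial\Omega$; these sets are $\operatorname{CC}(\mathcal T)$, $\operatorname{Ray}(\mathcal T)$, $\operatorname{MIS}(\mathcal T)$. A boundary maximal segment is a maximal connected union of boundary edges on one line; their set is $\operatorname{BMS}(\mathcal T)$. $\widehat{\operatorname{MS}}(\mathcal T)$ is the disjoint union of these four sets. $\mathcal T$ is reduced if no vertex is inserted merely to divide a straight edge into two collinear edges, every vertex lies on exactly one horizontal and exactly one vertical member of $\widehat{\operatorname{MS}}(\mathcal T)$, and the edges are exactly the closed subsegments between consecutive vertices on these members (so an interior and a boundary maximal segment of the same direction never meet collinearly at a common endpoint). **Smoothness.** A smoothness distribution is a map $\mathbf r:\mathcal T_1\to\{-1,0,1,\dots\}$ equal to $-1$ on boundary edges. It is constant along each maximal segment if for every $\rho\in\operatorname{MS}(\mathcal T)$ all edges $\tau\subset\rho$ have the same value $\mathbf r(\tau)$. **Structural isomorphism and structural class.** For $\rho\in\widehat{\operatorname{MS}}(\mathcal T)$ let $\operatorname{cor}(\rho)$ be its constant $t$-coordinate if horizontal, its constant $s$-coordinate if vertical. For reduced T-meshes, a bijection $\alpha:\widehat{\operatorname{MS}}(\mathcal T)\to\widehat{\operatorname{MS}}(\mathcal T')$ is a structural isomorphism if (i) it maps $\operatorname{CC},\operatorname{Ray},\operatorname{MIS},\operatorname{BMS}$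 of $\mathcal T$ onto those of $\mathcal T'$; (ii) for distinct $\rho,\eta$: $\rho\cap\eta\ne\varnothing\iff\alpha(\rho)\cap\alpha(\eta)\neq\varnothing$ (nonempty intersections are vertices, and $\alpha_0(\rho\cap\eta):=\alpha(\rho)\cap\alpha(\eta)$); (iii) $\rho\parallel\eta\iff\alpha(\rho)\parallel\alpha(\eta)$, and for parallel segments $\operatorname{cor}(\rho)<\operatorname{cor}(\eta)\iff\operatorname{cor}(\alpha(\rho))<\operatorname{cor}(\alpha(\eta))$. It is direction-preserving if it maps horizontal segments to horizontal ones and vertical to vertical ones. It induces bijections $\alpha_0$ of vertices, $\alpha_1$ of edges (the edge between consecutive vertices $\gamma,\gamma'$ of $\rho$ goes to the edge of $\alpha(\rho)$ between $\alpha_0(\gamma),\alpha_0(\gamma')$) and of cells. The structural class $[\mathcal T,\mathbf r]_{\mathrm I}^{+}$ is the set of pairs $(\mathcal T',\mathbf r')$ (reduced T-mesh with smoothness distribution) for which there is a direction-preserving structural isomorphism $\alpha$ from $\mathcal T$ to $\mathcal T'$ with $\mathbf r'(\alpha_1(\tau))=\mathbf r(\tau)$ for every $\tau\in\mathcal T_1^\circ$. **Euler characteristic.** $R_{m,m'}=\operatorname{span}_{\mathbb R}\{s^it^j:0\le i\le m,\,0\le j\le m'\}$. For an interior edge $\tau$ let $\ell_\tau$ be a nonzero affine linear polynomial vanishing on the line of $\tau$. Put $I_\tau^{\mathbf r}=\langle\ell_\tau^{\mathbf r(\tau)+1}\rangle\cap R_{m,m'}$ for $\tau\in\mathcal T_1^\circ$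 and $I_\gamma^{\mathbf r}=\sum_{\tau\ni\gamma,\tau\in\mathcal T_1^\circ}I_\tau^{\mathbf r}$ for $\gamma\in\mathcal T_0^\circ$. $\mathcal Q_{m,m'}^{\mathbf r}(\mathcal T^\circ)$ is the complex $0\to\bigoplus_{\sigma\in\mathcal T_2}[\sigma]R_{m,m'}\to\bigoplus_{\tau\in\mathcal T_1^\circ}[\tau]R_{m,m'}/I_\tau^{\mathbf r}\to\bigoplus_{\gamma\in\mathcal T_0^\circ}[\gamma]R_{m,m'}/I_\gamma^{\mathbf r}\to0$ with maps induced by the cellular boundary maps relative to $\partial\Omega$; its Euler characteristic is $\chi(\mathcal Q_{m,m'}^{\mathbf r}(\mathcal T^\circ))=\sum_{\sigma\in\mathcal T_2}\dim R_{m,m'}-\sum_{\tau\in\mathcal T_1^\circ}\dim(R_{m,m'}/I_\tau^{\mathbf r})+\sum_{\gamma\in\mathcal T_0^\circ}\dim(R_{m,m'}/I_\gamma^{\mathbf r})$. *)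

(* Defs.v *)
From HB Require Import structures.
From mathcomp Require Import all_boot all_order all_algebra.
From mathcomp Require Import finmap.
From mathcomp Require Import all_classical all_reals all_analysis.

Set Implicit Arguments.
Unset Strict Implicit.
Unset Printing Implicit Defensive.

Import Order.TTheory GRing.Theory Num.Theory.
Import numFieldNormedType.Exports.

Local Open Scope classical_set_scope.
Local Open Scope ring_scope.

(** * Plane topology *)

Definition frontier (X : topologicalType) (A : set X) : set X :=
  closure A `\` A°.

(* Path-connected, and every loop is homotopic to a constant loop within [A],
   relative to its base point. *)
Definition simply_connected (R : realType) (X : topologicalType) (A : set X) :
    Prop :=
  (forall x y, A x -> A y -> exists f : R -> X,
     [/\ {within `[0, 1], continuous f}, f @` `[0, 1] `<=` A,
         f 0 = x & f 1 = y]) /\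
  (forall f : R -> X,
     {within `[0, 1], continuous f} -> f @` `[0, 1] `<=` A -> f 0 = f 1 ->
     exists H : R * R -> X,
       [/\ {within `[0, 1] `*` `[0, 1], continuous H},
           H @` (`[0, 1] `*` `[0, 1]) `<=` A,
           forall x, x \in `[0, 1] -> H (x, 0) = f x,
           forall x, x \in `[0, 1] -> H (x, 1) = f 0 &
           forall u, u \in `[0, 1] -> H (0, u) = f 0 /\ H (1, u) = f 0]).

(** * Rectangles and segments *)

(* The rectangle [rs0, rs1] x [rt0, rt1]. *)
Record rect (R : Type) := Rect { rs0 : R; rs1 : R; rt0 : R; rt1 : R }.

(* The segment [lo, hi] x {cor} if [horiz], {cor} x [lo, hi] otherwise.  It
   serves both for edges and for maximal segments; the field [cor] is the
   constant coordinate of the segment. *)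
Record seg (R : Type) := Seg { horiz : bool; cor : R; lo : R; hi : R }.

Section Choice.
Variable R : choiceType.

Definition rect_code (a : rect R) := (rs0 a, rs1 a, rt0 a, rt1 a).
Definition rect_decode (x : R * R * R * R) :=
  let: (a, b, c, d) := x in Rect a b c d.
Lemma rect_codeK : cancel rect_code rect_decode. Proof. by case. Qed.
HB.instance Definition _ := Choice.copy (rect R) (can_type rect_codeK).

Definition seg_code (e : seg R) := (horiz e, cor e, lo e, hi e).
Definition seg_decode (x : bool * R * R * R) :=
  let: (h, c, a, b) := x in Seg h c a b.
Lemma seg_codeK : cancel seg_code seg_decode. Proof. by case. Qed.
HB.instance Definition _ := Choice.copy (seg R) (can_type seg_codeK).
End Choice.

Section TMesh.
Variable R : realType.
Implicit Types (a : rect R) (e rho eta : seg R).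

Definition rect_set a : set (R * R) := `[rs0 a, rs1 a] `*` `[rt0 a, rt1 a].

Definition seg_set e : set (R * R) :=
  if horiz e then `[lo e, hi e] `*` [set cor e]
  else [set cor e] `*` `[lo e, hi e].

Definition start e : R * R :=
  if horiz e then (lo e, cor e) else (cor e, lo e).
Definition stop e : R * R :=
  if horiz e then (hi e, cor e) else (cor e, hi e).

Definition parallel rho eta : Prop := horiz rho = horiz eta.

(** * T-meshes *)

Record premesh := Premesh {
  cells : {fset rect R};
  edges : {fset seg R}
}.
Implicit Types T : premesh.

Definition domain T : set (R * R) :=
  \bigcup_(a in [set` cells T]) rect_set a.

Definition vertices T : {fset R * R} :=
  (start @` edges T `|` stop @` edges T)%fset.

Record is_tmesh T : Prop := {
  cells_nondeg : forall a, a \in cells T -> rs0 a < rs1 a /\ rt0 a < rt1 a;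
  cells_disjoint : forall a b, a \in cells T -> b \in cells T -> a != b ->
    (rect_set a)° `&` (rect_set b)° = set0;
  domain_simply_connected : simply_connected R (domain T);
  domain_interior_connected : connected (domain T)°;
  edges_nondeg : forall e, e \in edges T -> lo e < hi e;
  edges_sub : forall e, e \in edges T ->
    seg_set e `<=` \bigcup_(a in [set` cells T]) frontier (rect_set a);
  cell_boundary : forall a, a \in cells T ->
    exists2 F : set (seg R), F `<=` [set` edges T] &
      frontier (rect_set a) = \bigcup_(e in F) seg_set e;
  cells_meet : forall a b, a \in cells T -> b \in cells T -> a != b ->
    rect_set a `&` rect_set b =
      frontier (rect_set a) `&` frontier (rect_set b);
  cells_meet_edges : forall a b, a \in cells T -> b \in cells T -> a != b ->
    exists F : set (seg R), exists V : set (R * R),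
      [/\ F `<=` [set` edges T], V `<=` [set` vertices T] &
          rect_set a `&` rect_set b = \bigcup_(e in F) seg_set e `|` V];
  edges_meet : forall e f, e \in edges T -> f \in edges T -> e != f ->
    seg_set e `&` seg_set f `<=` [set` vertices T]
}.

Definition int_edges T : {fset seg R} :=
  [fset e in edges T | `[< seg_set e `&` (domain T)° !=set0 >]]%fset.

Definition bnd_edges T : {fset seg R} :=
  [fset e in edges T | e \notin int_edges T]%fset.

Definition int_vertices T : {fset R * R} :=
  [fset v in vertices T | `[< (domain T)° v >]]%fset.

(** * Maximal segments *)

(* A connected union of edges on one line is exactly a nondegenerate segment
   that is a union of edges. *)
Definition segment_of (E : {fset seg R}) rho : Prop :=
  lo rho < hi rho /\
  exists2 F : set (seg R), F `<=` [set` E] &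
    seg_set rho = \bigcup_(e in F) seg_set e.

Definition maximal_segments (E : {fset seg R}) : set (seg R) :=
  [set rho | segment_of E rho /\
     forall eta, segment_of E eta -> seg_set rho `<=` seg_set eta ->
       seg_set eta = seg_set rho].

Definition MS T := maximal_segments (int_edges T).
Definition BMS T := maximal_segments (bnd_edges T).

Definition CC T : set (seg R) :=
  [set rho | [/\ MS T rho, frontier (domain T) (start rho) &
                 frontier (domain T) (stop rho)]].

Definition Ray T : set (seg R) :=
  [set rho | MS T rho /\
     (frontier (domain T) (start rho) /\ ~ frontier (domain T) (stop rho) \/
      ~ frontier (domain T) (start rho) /\ frontier (domain T) (stop rho))].

Definition MIS T : set (seg R) :=
  [set rho | MS T rho /\ seg_set rho `&` frontier (domain T) = set0].

(* The four sets are automatically disjoint: members of [MS T] meet the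
   interior of the domain, members of [BMS T] do not. *)
Definition MShat T : set (seg R) := CC T `|` Ray T `|` MIS T `|` BMS T.

Record reduced T : Prop := {
  no_dividing_vertex : forall v, v \in vertices T ->
    ~ exists e f, [/\ e != f, parallel e f, cor e = cor f &
        [set g | g \in edges T /\ seg_set g v] = [set e; f]];
  vertex_hseg : forall v, v \in vertices T ->
    exists! rho, [/\ MShat T rho, horiz rho & seg_set rho v];
  vertex_vseg : forall v, v \in vertices T ->
    exists! rho, [/\ MShat T rho, ~~ horiz rho & seg_set rho v];
  (* The last condition says that [start e] and [stop e] are vertices with no
     vertex in between. *)
  edges_consecutive : forall e, e \in edges T <->
    exists rho, [/\ MShat T rho, lo e < hi e, seg_set e `<=` seg_set rho &
                    seg_set e `&` [set` vertices T] = [set start e; stop e]]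
}.

Definition reduced_tmesh T : Prop := is_tmesh T /\ reduced T.

(** * Smoothness distributions *)

(* Only the values on [edges T] are relevant. *)
Definition smoothness T (r : seg R -> int) : Prop :=
  (forall e, e \in edges T -> -1 <= r e) /\
  (forall e, e \in bnd_edges T -> r e = -1).

Definition constant_along_MS T (r : seg R -> int) : Prop :=
  forall rho e f, MS T rho -> e \in edges T -> f \in edges T ->
    seg_set e `<=` seg_set rho -> seg_set f `<=` seg_set rho -> r e = r f.

(** * Structural isomorphisms *)

Record structural_iso T T' (alpha : seg R -> seg R) : Prop := {
  iso_bij : set_bij (MShat T) (MShat T') alpha;
  iso_CC : alpha @` CC T = CC T';
  iso_Ray : alpha @` Ray T = Ray T';
  iso_MIS : alpha @` MIS T = MIS T';
  iso_BMS : alpha @` BMS T = BMS T';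
  iso_meet : forall rho eta, MShat T rho -> MShat T eta -> rho != eta ->
    (seg_set rho `&` seg_set eta !=set0 <->
     seg_set (alpha rho) `&` seg_set (alpha eta) !=set0);
  iso_parallel : forall rho eta, MShat T rho -> MShat T eta ->
    (parallel rho eta <-> parallel (alpha rho) (alpha eta));
  iso_cor : forall rho eta, MShat T rho -> MShat T eta -> parallel rho eta ->
    (cor rho < cor eta <-> cor (alpha rho) < cor (alpha eta))
}.

Definition direction_preserving T (alpha : seg R -> seg R) : Prop :=
  forall rho, MShat T rho -> horiz (alpha rho) = horiz rho.

(* [xget] selects an element of the set, a singleton for a vertex (resp. an
   edge) of a reduced T-mesh and a structural isomorphism. *)
Definition vertex_map T (alpha : seg R -> seg R) (v : R * R) : R * R :=
  xget v [set w | exists rho eta,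
    [/\ MShat T rho /\ MShat T eta, rho != eta,
        seg_set rho `&` seg_set eta = [set v] &
        seg_set (alpha rho) `&` seg_set (alpha eta) = [set w]]].

Definition edge_map T T' (alpha : seg R -> seg R) e : seg R :=
  xget e [set e' | e' \in edges T' /\ exists rho,
    [/\ MShat T rho, seg_set e `<=` seg_set rho,
        seg_set e' `<=` seg_set (alpha rho) &
        [set start e'; stop e'] =
          [set vertex_map T alpha (start e); vertex_map T alpha (stop e)]]].

Definition structural_class T (r : seg R -> int) :
    set (premesh * (seg R -> int)) :=
  [set p | [/\ reduced_tmesh p.1, smoothness p.1 p.2 &
     exists alpha, [/\ structural_iso T p.1 alpha,
       direction_preserving T alpha &
       forall e, e \in int_edges T -> p.2 (edge_map T p.1 alpha e) = r e]]].

End TMesh.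

(** * Euler characteristic *)

Section Euler.
Variables (R : realType) (m m' : nat).

(* The polynomials in s and t: s is the inner variable, t the outer one. *)
Definition svar : {poly {poly R}} := 'X%:P.
Definition tvar : {poly {poly R}} := 'X.
Definition scalar (c : R) : {poly {poly R}} := c%:P%:P.

(* [R_(m, m')] is represented by the coefficient matrices in the monomial
   basis. *)
Local Notation V := 'M[R]_(m.+1, m'.+1).

Definition bipoly (A : V) : {poly {poly R}} :=
  \sum_(i < m.+1) \sum_(j < m'.+1) scalar (A i j) * svar ^+ i * tvar ^+ j.

Definition line_form (e : seg R) : {poly {poly R}} :=
  if horiz e then tvar - scalar (cor e) else svar - scalar (cor e).

Definition principal_ideal (f : {poly {poly R}}) : set {poly {poly R}} :=
  [set p | exists q, p = q * f].

(* The subspace with carrier [P], if there is one. *)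
Definition vspace_of (P : set V) : {vspace V} :=
  xget 0%VS [set U : {vspace V} | forall A, A \in U <-> P A].

Lemma vspace_ofP (P : set V) : P 0 ->
  (forall (c : R) A B, P A -> P B -> P (c *: A + B)) ->
  forall A, A \in vspace_of P <-> P A.
Proof.
move=> P0 PD; rewrite /vspace_of; case: xgetP => [U _ //|noU].
pose Q (U : {vspace V}) := forall A, A \in U -> P A.
pose D n := `[< exists2 U : {vspace V}, Q U & \dim U = n >].
have exD : exists n, D n.
  by exists 0%N; apply/asboolP; exists 0%VS; rewrite ?dimv0// => A;
    rewrite memv0 => /eqP ->.
have ubD n : D n -> (n <= \dim {:V})%N.
  by move=> /asboolP[U _ <-]; exact: dimvS (subvf U).
case: (ex_maxnP exD ubD) => n /asboolP[U QU dimU] maxn.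
case: (noU U) => A; split=> [/QU //|PA].
have QUA : Q (U + <[A]>)%VS.
  move=> _ /memv_addP[B BU [_ /vlineP[c ->] ->]].
  by rewrite addrC; apply: PD => //; exact: QU.
have /maxn dimUA : D (\dim (U + <[A]>)%VS) by apply/asboolP; exists (U + <[A]>)%VS.
have /eqP -> : U == (U + <[A]>)%VS by rewrite eqEdim addvSl dimU.
by rewrite (subvP (addvSr _ _)) ?memv_line.
Qed.

Definition edge_ideal (r : seg R -> int) (e : seg R) : {vspace V} :=
  vspace_of [set A | principal_ideal (line_form e ^+ absz (r e + 1)) (bipoly A)].

Lemma edge_idealP r e A : A \in edge_ideal r e <->
  principal_ideal (line_form e ^+ absz (r e + 1)) (bipoly A).
Proof.
apply: (vspace_ofP (P := fun A => principal_ideal _ (bipoly A))).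
  exists 0; rewrite mul0r /bipoly big1// => i _; rewrite big1// => j _.
  by rewrite mxE /scalar !polyC0 !mul0r.
move=> c A1 A2 [q1 h1] [q2 h2]; exists (scalar c * q1 + q2).
rewrite mulrDl -mulrA -h1 -h2 /bipoly mulr_sumr -big_split/=.
apply: eq_bigr => i _; rewrite mulr_sumr -big_split/=; apply: eq_bigr => j _.
by rewrite !mxE /scalar !polyCD !polyCM !mulrDl !mulrA.
Qed.

Definition vertex_ideal (T : premesh R) (r : seg R -> int) (v : R * R) :
    {vspace V} :=
  (\sum_(e <- int_edges T | `[< seg_set e v >]) edge_ideal r e)%VS.

Definition quotient_dim (U : {vspace V}) : int :=
  (\dim {:V})%:Z - (\dim U)%:Z.

Definition euler_char (T : premesh R) (r : seg R -> int) : int :=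
  \sum_(a <- cells T) (\dim {:V})%:Z
  - \sum_(e <- int_edges T) quotient_dim (edge_ideal r e)
  + \sum_(v <- int_vertices T) quotient_dim (vertex_ideal T r v).

End Euler.

(* Main.v *)
(** Let [alpha] be a direction-preserving structural isomorphism from [T] to
    [T'].  It suffices to compare the Euler characteristics of [T] and [T'].

    In a reduced T-mesh every vertex is the intersection of the unique
    horizontal and the unique vertical maximal segment through it, and edges
    join consecutive vertices of a maximal segment; hence [alpha] induces
    bijections of vertices and edges.  An edge is interior iff its maximal
    segment is not a boundary one, and a vertex is interior iff neither of its
    two segments is a boundary one, so these bijections respect interiority.
    The translation of the plane moving a vertex to its image maps the edge
    ideals at the vertex to those at the image, so all quotients keep their
    dimension.

    The cells are counted by their corners: four times the number of cells is
    the sum over the vertices of the number of cell corners there.  That number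
    is determined by the edges at the vertex: a pair of perpendicular edges
    always spans a cell corner, except where two boundary segments cross; there
    exactly two opposite quadrants are covered.  Reentrant corners do not occur
    because a boundary segment is never continued by an interior one. *)
From HB Require Import structures.
Require Import Defs.
From mathcomp Require Import all_boot all_order all_algebra.
From mathcomp Require Import finmap ring lra.
From mathcomp Require Import all_classical all_reals all_analysis.
(* [scalar] is also the name of a MathComp notion; this restores the one of [Defs]. *)
Import Defs.

Set Implicit Arguments.
Unset Strict Implicit.
Unset Printing Implicit Defensive.

Import Order.TTheory GRing.Theory Num.Theory.
Import numFieldNormedType.Exports.

Local Open Scope classical_set_scope.
Local Open Scope ring_scope.

(** * Translation of the ideals *)

Section Translation.
Variable R : realType.
Implicit Types a b c : R.

(** The substitution $s \mapsto s+a$, $t \mapsto t+b$: the coefficients are polynomials in $s$, so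
    [a] acts on them, while [b] acts on the outer variable. *)
Definition translate a b (p : {poly {poly R}}) : {poly {poly R}} :=
  map_poly (comp_poly ('X + a%:P)) p \Po ('X + b%:P%:P).

Fact translate_is_zmod_morphism a b : zmod_morphism (translate a b).
Proof. by move=> p q; rewrite /translate !raddfB. Qed.
HB.instance Definition _ a b := GRing.isZmodMorphism.Build _ _ (translate a b)
  (translate_is_zmod_morphism a b).
Fact translate_is_monoid_morphism a b : monoid_morphism (translate a b).
Proof.
by split=> [|p q]; rewrite /translate ?rmorph1 ?rmorphM//= comp_polyM.
Qed.
HB.instance Definition _ a b := GRing.isMonoidMorphism.Build _ _ (translate a b)
  (translate_is_monoid_morphism a b).

Lemma translate_svar a b : translate a b (svar R) = svar R + scalar a.
Proof.
by rewrite /translate/svar/scalar map_polyC/= comp_polyC comp_polyX polyCD.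
Qed.

Lemma translate_tvar a b : translate a b (tvar R) = tvar R + scalar b.
Proof. by rewrite /translate /tvar map_polyX comp_polyX. Qed.

Lemma translate_scalar a b c : translate a b (scalar c) = scalar c.
Proof. by rewrite /translate /scalar map_polyC/= !comp_polyC. Qed.

(** The substitution $X \mapsto X+c$ on polynomials of degree less than [n]: row [i] holds the
    coefficients of $(X+c)^i$. *)
Definition shift_mx n c : 'M[R]_n :=
  \matrix_(i < n, j < n) (('X + c%:P) ^+ i)`_j.

Lemma expr_shift n c (i : 'I_n) :
  ('X + c%:P) ^+ i = \sum_(k < n) (shift_mx n c i k)%:P * 'X^k.
Proof.
have sz : (size (('X + c%:P) ^+ i) <= n)%N.
  rewrite -[c]opprK polyCN; rewrite size_exp_XsubC; exact: ltn_ord.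
rewrite -[LHS](coefK) (poly_def _ _).
rewrite (big_ord_widen n (fun k => (('X + c%:P) ^+ i)`_k *: 'X^k)) // big_mkcond.
apply: eq_bigr => k _; rewrite mxE mul_polyC; case: ifP => // /negbT.
by rewrite -leqNgt => /leq_sizeP -> //; rewrite scale0r.
Qed.

Lemma svar_shift n c (i : 'I_n) : (svar R + scalar c) ^+ i =
  \sum_(k < n) scalar (shift_mx n c i k) * svar R ^+ k.
Proof.
rewrite /svar /scalar -polyCD -rmorphXn/= expr_shift rmorph_sum/=.
by apply: eq_bigr => k _; rewrite polyCM rmorphXn.
Qed.

Lemma tvar_shift n c (i : 'I_n) : (tvar R + scalar c) ^+ i =
  \sum_(k < n) scalar (shift_mx n c i k) * tvar R ^+ k.
Proof.
rewrite (_ : tvar R + scalar c = map_poly polyC ('X + c%:P)); last first.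
  by rewrite rmorphD/= map_polyX map_polyC.
rewrite -rmorphXn/= expr_shift rmorph_sum/=.
by apply: eq_bigr => k _; rewrite rmorphM/= map_polyC map_polyXn.
Qed.

(** * Translations acting on coefficient matrices *)

Section Translate_mx.
Variables m m' : nat.
Local Notation V := 'M[R]_(m.+1, m'.+1).

Lemma coef_monomial c i j k l :
  (scalar c * svar R ^+ i * tvar R ^+ j)`_l`_k = c *+ ((k == i) && (l == j)).
Proof.
rewrite /scalar /svar /tvar -!rmorphXn/= -polyCM coefCM coefXn.
by case: (l == j); rewrite ?andbF ?mulr0 ?coef0// mulr1 coefCM coefXn andbT mulr_natr.
Qed.

Lemma coef_bipoly (A : V) (i : 'I_m.+1) (j : 'I_m'.+1) : (bipoly A)`_j`_i = A i j.
Proof.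
rewrite /bipoly !coef_sum (bigD1 i)//= !coef_sum (bigD1 j)//= coef_monomial !eqxx.
rewrite big1 => [|l lj]; last first.
  by rewrite coef_monomial eqxx !val_eqE [j == l]eq_sym (negbTE lj) andbF.
rewrite big1 ?addr0// => k ki; rewrite !coef_sum big1// => l _.
by rewrite coef_monomial !val_eqE [i == k]eq_sym (negbTE ki).
Qed.

Lemma bipoly_inj : injective (@bipoly R m m').
Proof. by move=> A B AB; apply/matrixP => i j; rewrite -!coef_bipoly AB. Qed.

(** A translation raises the degree in neither variable, so it acts on $R_{m,m'}$. Rows of [A]
    belong to powers of $s$ and columns to powers of $t$, hence the transposed shift on the left. *)
Definition translate_mx a b (A : V) : V :=
  (shift_mx _ a)^T *m A *m shift_mx _ b.

Fact translate_mx_is_linear a b : linear (translate_mx a b).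
Proof. by move=> c A B; rewrite /translate_mx mulmxDr mulmxDl -scalemxAr -scalemxAl. Qed.
HB.instance Definition _ a b := GRing.isLinear.Build _ _ _ _ (translate_mx a b)
  (translate_mx_is_linear a b).

Lemma bipoly_translate a b (A : V) :
  bipoly (translate_mx a b A) = translate a b (bipoly A).
Proof.
have scalarD : {morph @scalar R : x y / x + y} by move=> x y; rewrite /scalar !polyCD.
have scalarM : {morph @scalar R : x y / x * y} by move=> x y; rewrite /scalar !polyCM.
have scalar0 : @scalar R 0 = 0 by rewrite /scalar !polyC0.
rewrite /bipoly rmorph_sum/=.
(* Both sides expand into the same fourfold sum, up to the order of summation and the grouping of
   factors. *)
transitivity (\sum_(i < m.+1) \sum_(j < m'.+1) \sum_(k < m.+1) \sum_(l < m'.+1)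
    scalar (A i j) * (scalar (shift_mx _ a i k) * svar R ^+ k)
                   * (scalar (shift_mx _ b j l) * tvar R ^+ l)); last first.
  apply: eq_bigr => i _; rewrite rmorph_sum; apply: eq_bigr => j _ /=.
  rewrite !rmorphM !rmorphXn/= translate_scalar translate_svar translate_tvar.
  rewrite svar_shift tvar_shift [X in X * _]mulr_sumr mulr_suml.
  by apply: eq_bigr => k _; rewrite mulr_sumr.
transitivity (\sum_(k < m.+1) \sum_(l < m'.+1) \sum_(i < m.+1) \sum_(j < m'.+1)
    scalar (A i j) * (scalar (shift_mx _ a i k) * svar R ^+ k)
                   * (scalar (shift_mx _ b j l) * tvar R ^+ l)).
  apply: eq_bigr => k _; apply: eq_bigr => l _.
  rewrite mxE exchange_big/= (big_morph _ scalarD scalar0) !mulr_suml.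
  apply: eq_bigr => j _; rewrite mxE mulr_suml (big_morph _ scalarD scalar0) !mulr_suml.
  apply: eq_bigr => i _; rewrite mxE !scalarM.
  by ring.
under eq_bigr => k _ do rewrite exchange_big/=.
rewrite exchange_big/=; apply: eq_bigr => i _.
under eq_bigr => k _ do rewrite exchange_big/=.
by rewrite exchange_big.
Qed.

Lemma translateK a b (A : V) :
  translate (- a) (- b) (translate a b (bipoly A)) = bipoly A.
Proof.
rewrite /bipoly !rmorph_sum/=; apply: eq_bigr => i _.
rewrite !rmorph_sum/=; apply: eq_bigr => j _.
rewrite !rmorphM !rmorphXn/= !translate_scalar translate_svar translate_tvar.
rewrite !rmorphD/= !translate_scalar translate_svar translate_tvar.
by rewrite /scalar !polyCN !addrNK.
Qed.

Lemma translate_mx_inj a b : injective (translate_mx a b).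
Proof.
move=> A B /(congr1 (@bipoly R m m')); rewrite !bipoly_translate.
by move=> /(congr1 (translate (- a) (- b))); rewrite !translateK; apply: bipoly_inj.
Qed.

(** Substituting $s+a$ for $s$ turns $s-c$ into $s-(c-a)$: the zero line moves opposite to the
    translation vector, whence the minus sign. *)
Lemma translate_line_form a b e e' : horiz e' = horiz e ->
  cor e' = cor e - (if horiz e then b else a) ->
  translate a b (line_form e) = line_form e'.
Proof.
rewrite /line_form => -> ->; case: (horiz e); rewrite rmorphB/= translate_scalar;
  rewrite ?translate_svar ?translate_tvar /scalar !polyCB opprB addrA addrAC//.
Qed.

Lemma translate_edge_ideal a b (r r' : seg R -> int) e e' A :
  horiz e' = horiz e -> cor e' = cor e - (if horiz e then b else a) ->
  r' e' = r e ->
  A \in edge_ideal m m' r e -> translate_mx a b A \in edge_ideal m m' r' e'.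
Proof.
move=> he ce re /edge_idealP[q Aq]; apply/edge_idealP; exists (translate a b q).
by rewrite bipoly_translate Aq rmorphM rmorphXn/= (translate_line_form he ce) re.
Qed.

(** The injective map [translate_mx a b] sends each summand into a summand of the second sum. Using
    this again with the opposite translation gives equality of dimensions. Lists with a filter cover
    both single edge ideals and vertex ideals. *)
Lemma dim_sum_edge_ideal a b (r r' : seg R -> int) (E E' : seq (seg R))
    (P P' : pred (seg R)) :
  (forall e, e \in E -> P e -> exists e', [/\ e' \in E', P' e',
     horiz e' = horiz e, cor e' = cor e - (if horiz e then b else a) &
     r' e' = r e]) ->
  (\dim (\sum_(e <- E | P e) edge_ideal m m' r e)
    <= \dim (\sum_(e <- E' | P' e) edge_ideal m m' r' e))%N.
Proof.
move=> EE'; set U := (\sum_(e <- E | P e) _)%VS.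
pose f := linfun (translate_mx a b).
have f_inj : (lker f == 0)%VS.
  by apply/lker0P => A B; rewrite !lfunE; exact: translate_mx_inj.
rewrite -(limg_dim_eq (f := f) (U := U)); last by rewrite (eqP f_inj) capv0.
apply: dimvS; rewrite limg_sum big_seq_cond.
apply: (big_ind (fun W => (W <= _)%VS)) => [|W1 W2 W1S W2S|e /andP[eE Pe]].
- exact: sub0v.
- by rewrite subv_add W1S.
have [e' [e'E' Pe' he ce re]] := EE' _ eE Pe.
have : (f @: edge_ideal m m' r e <= edge_ideal m m' r' e')%VS.
  apply/subvP => _ /memv_imgP[A Ae ->]; rewrite lfunE.
  exact: translate_edge_ideal Ae.
move=> /subv_trans; apply; rewrite big_mkcond (big_rem e' e'E')/= Pe'.
exact: addvSl.
Qed.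

End Translate_mx.
End Translation.

(** * Rectangles and segments in coordinates *)

Section Coordinates.
Variable R : realType.
Implicit Types (a b : rect R) (e f rho eta : seg R) (u v w p q : R * R).
Implicit Types (d i j : bool) (x y l c : R).

(** Directions are encoded as in [horiz]: [axis (horiz e)] is the coordinate that varies along [e]
    and [axis (~~ horiz e)] the constant one. One argument then serves both directions. *)
Definition axis d p : R := if d then p.1 else p.2.
Definition pt d x y : R * R := if d then (x, y) else (y, x).
Definition rlo d a : R := if d then rs0 a else rt0 a.
Definition rhi d a : R := if d then rs1 a else rt1 a.
Definition inner a p := forall d, rlo d a < axis d p < rhi d a.

Lemma axis_pt d x y : axis d (pt d x y) = x. Proof. by case: d. Qed.
Lemma axisN_pt d x y : axis (~~ d) (pt d x y) = y. Proof. by case: d. Qed.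
Definition axisE := (axis_pt, axisN_pt).

Lemma axisP d p q : axis d p = axis d q -> axis (~~ d) p = axis (~~ d) q -> p = q.
Proof. by case: d p q => -[? ?] [? ?] /= -> ->. Qed.

Lemma pt_axis d p : pt d (axis d p) (axis (~~ d) p) = p.
Proof. by case: d p => -[]. Qed.

Lemma startE e : start e = pt (horiz e) (lo e) (cor e).
Proof. by rewrite /start /pt; case: (horiz e). Qed.
Lemma stopE e : stop e = pt (horiz e) (hi e) (cor e).
Proof. by rewrite /stop /pt; case: (horiz e). Qed.

Lemma rect_setE a p : rect_set a p <-> forall d, rlo d a <= axis d p <= rhi d a.
Proof.
rewrite /rect_set; split=> [[/= h1 h2] []|h]; first by rewrite in_itv in h1.
  by rewrite in_itv in h2.
by split=> /=; rewrite in_itv; [exact: (h true)|exact: (h false)].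
Qed.

Lemma rect_setP d a p : rlo d a <= axis d p <= rhi d a ->
  rlo (~~ d) a <= axis (~~ d) p <= rhi (~~ d) a -> rect_set a p.
Proof. by move=> h1 h2; apply/rect_setE; case: d h1 h2 => h1 h2 []. Qed.

Lemma innerP d a p : rlo d a < axis d p < rhi d a ->
  rlo (~~ d) a < axis (~~ d) p < rhi (~~ d) a -> inner a p.
Proof. by case: d => h1 h2 []. Qed.

Lemma seg_setE e p : seg_set e p <->
  lo e <= axis (horiz e) p <= hi e /\ axis (~~ horiz e) p = cor e.
Proof.
rewrite /seg_set; case: (horiz e); split => /= -[] /=; rewrite ?in_itv //.
Qed.

Lemma seg_eq e f : horiz e = horiz f -> start e = start f -> stop e = stop f -> e = f.
Proof.
case: e f => [h c l u] [h' c' l' u']; rewrite !startE !stopE/= => <-.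
by case: h => -[-> ->] [->].
Qed.

Lemma nbhs_box p (A : set (R * R)) : nbhs p A <->
  exists2 eps : R, 0 < eps & forall q, (forall d, `|axis d p - axis d q| < eps) -> A q.
Proof.
rewrite -nbhs_ballE; split=> [[eps /= eps0 pA]|[eps eps0 pA]]; exists eps => //.
  by move=> q pq; apply: pA; split; [exact: (pq true)|exact: (pq false)].
by move=> q [/= h1 h2]; apply: pA => -[].
Qed.

(** Tells whether the points just to the right ([i]) or just to the left ([~~ i]) of [x] lie in
    $[l,c]$. *)
Definition inhalf i l x c := if i then l <= x < c else l < x <= c.

Lemma inhalfW i l x c : inhalf i l x c -> l <= x <= c.
Proof. by case: i => /andP[h1 h2]; rewrite ?h1 ?h2 ?(ltW h1) ?(ltW h2). Qed.

Lemma inhalf_strict i l x c : l < x < c -> inhalf i l x c.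
Proof. by case: i => /andP[h1 h2]; rewrite /inhalf ?h1 ?h2 ?(ltW h1) ?(ltW h2). Qed.

Lemma inhalf_lt i l x c : inhalf i l x c -> l < c.
Proof. by case: i => /andP[h1 h2]; [apply: le_lt_trans h2|apply: lt_le_trans h2]. Qed.

(* [y] is so close to [x], on its right ([i]) or left ([~~ i]), that an interval with
   ends in [L] contains [y] iff it contains the half-neighbourhood of [x]. *)
Definition germ (L : seq R) i x y := (if i then x < y else y < x) /\
  forall l c, l \in L -> c \in L ->
  (l <= y <= c -> inhalf i l x c) /\ (inhalf i l x c -> l < y < c).

Lemma exists_germ (L : seq R) i x eps : 0 < eps ->
  exists2 y, germ L i x y & `|x - y| < eps.
Proof.
move=> eps0.
(* [h] is smaller than [eps] and than the distance from [x] to every element of [L] other than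
   [x]. *)
have [h h0 /andP[heps hL]] : exists2 h : R, 0 < h &
    (h < eps) && all (fun c => (c == x) || (h < `|c - x|)) L.
  elim: L => [|c L [h h0 /andP[heps hL]]].
    by exists (eps / 2); [rewrite divr_gt0|rewrite andbT; lra].
  have [->|cx] := eqVneq c x; first by exists h => //=; rewrite eqxx heps.
  have cx0 : 0 < `|c - x| by rewrite normr_gt0 subr_eq0.
  exists (Num.min h (`|c - x| / 2)).
    by rewrite lt_min h0 divr_gt0.
  rewrite gt_min heps/= (negbTE cx)/= gt_min; apply/andP; split.
    by apply/orP; right; lra.
  apply/allP => k /(allP hL)/orP[->//|hk]; apply/orP; right.
  by rewrite gt_min hk.
exists (if i then x + h else x - h); last first.
  by case: i; rewrite ?opprD ?opprK addrA subrr add0r ?normrN gtr0_norm.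
split; first by case: i; lra.
move=> l c /(allP hL) hl /(allP hL) hc.
have hl' : l = x \/ l + h < x \/ x + h < l.
  case/orP: hl => [/eqP->|]; first by left.
  by rewrite lter_normr => /orP[|] ?; right; [right|left]; lra.
have hc' : c = x \/ c + h < x \/ x + h < c.
  case/orP: hc => [/eqP->|]; first by left.
  by rewrite lter_normr => /orP[|] ?; right; [right|left]; lra.
rewrite /inhalf; case: i; split => /andP[h1 h2]; apply/andP; split; lra.
Qed.

(** If $c=y$, the degenerate interval $[c,c]$ contains [y], but it contains no half-neighbourhood of
    [x]. *)
Lemma germ_neq L i x y c : germ L i x y -> c \in L -> c <> y.
Proof.
move=> [_ g] cL cy; have [+ _] := g c c cL cL.
by rewrite cy lexx => /(_ isT) /inhalf_lt; rewrite ltxx.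
Qed.

Lemma inner_interior a p : inner a p -> (rect_set a)° p.
Proof.
move=> ap; apply/nbhs_box.
pose D d := Num.min (axis d p - rlo d a) (rhi d a - axis d p).
have D0 d : 0 < D d by have /andP[? ?] := ap d; rewrite lt_min !subr_gt0; apply/andP.
exists (Num.min (D true) (D false)); first by rewrite lt_min !D0.
move=> q pq; apply/rect_setE => d.
have : `|axis d p - axis d q| < D d.
  by case: d; apply: (lt_le_trans (pq _)); rewrite ge_min lexx ?orbT.
rewrite /D lt_min ltr_norml ltr_norml => /andP[/andP[h1 h2] /andP[h3 h4]].
by apply/andP; split; lra.
Qed.

Lemma interior_inner a p : (rect_set a)° p -> inner a p.
Proof.
move=> /nbhs_box[eps eps0 pA] d.
have [h1 h2] : rect_set a (pt d (axis d p - eps / 2) (axis (~~ d) p)) /\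
   rect_set a (pt d (axis d p + eps / 2) (axis (~~ d) p)).
  have He : `|eps / 2| < eps by rewrite gtr0_norm ?divr_gt0//; lra.
  split; apply: pA => d'; (have [->|->] : d' = d \/ d' = ~~ d
     by case: (d) (d') => -[]; by [left|right]); rewrite !axisE ?subrr ?normr0//.
    by rewrite opprB addrC subrK.
  by rewrite opprD addrA subrr add0r normrN.
move: h1 h2 => /rect_setE/(_ d) + /rect_setE/(_ d); rewrite !axisE => /andP[? ?] /andP[? ?].
by apply/andP; split; lra.
Qed.

Lemma closed_rect a : closed (rect_set a).
Proof.
rewrite (_ : rect_set a = (fst @^-1` `[rs0 a, rs1 a]) `&` (snd @^-1` `[rt0 a, rt1 a]))//.
apply: closedI; apply: closed_comp; try exact: interval_closed; move=> x _;
  [exact: cvg_fst|exact: cvg_snd].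
Qed.

Lemma frontier_rectE a p : frontier (rect_set a) p <-> rect_set a p /\ ~ inner a p.
Proof.
rewrite /frontier -(closure_id _).1; last exact: closed_rect.
by split=> -[ap nap]; split=> // h; apply: nap;
  [exact: inner_interior|exact: interior_inner].
Qed.

End Coordinates.

(** * Cells around a point *)

Section Cover.
Variable R : realType.
Implicit Types (a b : rect R) (e f rho eta : seg R) (u v w p q : R * R).
Implicit Types (d i j : bool) (x y l c : R).

(* The quadrant at [p] pointing to direction [i] along [d] and [j] across [d]
   ([true] being the positive direction) starts inside [a]. *)
Definition covers d i j p a :=
  inhalf i (rlo d a) (axis d p) (rhi d a) &&
  inhalf j (rlo (~~ d) a) (axis (~~ d) p) (rhi (~~ d) a).

Lemma coversC d i j p a : covers (~~ d) j i p a = covers d i j p a.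
Proof. by rewrite /covers negbK andbC. Qed.

(** The side from which [a] extends in direction [i], so the low one for the positive direction.
    Thus [a] occupies the quadrant [(i, j)] at [corner d i j a]; likewise an edge leaves its
    [endpoint i] in direction [i]. *)
Definition rside d i a := if i then rlo d a else rhi d a.

Definition corner d i j a : R * R := pt d (rside d i a) (rside (~~ d) j a).

(* The cell [a] lies on the [j] side of [e] and has a side containing [e]. *)
Definition flanks j e a := [/\ cor e = rside (~~ horiz e) j a,
  rlo (horiz e) a <= lo e & hi e <= rhi (horiz e) a].

Definition endpoint i e : R * R := if i then start e else stop e.

Lemma axis_endpoint d i e : horiz e = d ->
  axis d (endpoint i e) = if i then lo e else hi e.
Proof. by move=> <-; rewrite /endpoint startE stopE; case: i; rewrite axisE. Qed.

Lemma axisN_endpoint d i e : horiz e = d -> axis (~~ d) (endpoint i e) = cor e.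
Proof. by move=> <-; rewrite /endpoint startE stopE; case: i; rewrite axisE. Qed.

Variable T : premesh R.

Definition cov d i j p := exists2 a, a \in cells T & covers d i j p a.

Definition flanked j e := exists2 a, a \in cells T & flanks j e a.

Definition has_edge d i v := exists e, [/\ e \in edges T, horiz e = d & endpoint i e = v].

Lemma covC d i j p : cov (~~ d) j i p <-> cov d i j p.
Proof. by split=> -[a aT pa]; exists a => //; move: pa; rewrite coversC. Qed.

Definition coords : seq R :=
  flatten [seq [:: rs0 a; rs1 a; rt0 a; rt1 a] | a <- cells T] ++
  flatten [seq [:: cor e; lo e; hi e] | e <- edges T].

Lemma coords_rlo d a : a \in cells T -> rlo d a \in coords.
Proof.
move=> aT; rewrite mem_cat; apply/orP; left; apply/flatten_mapP; exists a => //.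
by rewrite /rlo; case: d; rewrite !inE eqxx ?orbT.
Qed.
Lemma coords_rhi d a : a \in cells T -> rhi d a \in coords.
Proof.
move=> aT; rewrite mem_cat; apply/orP; left; apply/flatten_mapP; exists a => //.
by rewrite /rhi; case: d; rewrite !inE eqxx ?orbT.
Qed.
Lemma coords_edge e : e \in edges T ->
  [/\ cor e \in coords, lo e \in coords & hi e \in coords].
Proof.
by move=> eT; split; rewrite mem_cat; apply/orP; right; apply/flatten_mapP; exists e => //;
  rewrite !inE eqxx ?orbT.
Qed.

Lemma int_cov p : (domain T)° p <-> forall i j, cov true i j p.
Proof.
split=> [/nbhs_box[eps eps0 pT] i j|pT].
  have [x [_ gx] px] := exists_germ coords i p.1 eps0.
  have [y [_ gy] py] := exists_germ coords j p.2 eps0.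
  have [|a aT /rect_setE axy] := pT (x, y); first by case.
  exists a => //; apply/andP; split.
    by apply: (gx _ _ (coords_rlo true aT) (coords_rhi true aT)).1 (axy true).
  by apply: (gy _ _ (coords_rlo false aT) (coords_rhi false aT)).1 (axy false).
(* A covering cell contains a closed quarter of a box around [p]; the four quarters together fill a
   neighbourhood. *)
have quad i j : exists2 eps, 0 < eps & forall q, (forall d, `|axis d p - axis d q| < eps) ->
    (if i then p.1 <= q.1 else q.1 <= p.1) -> (if j then p.2 <= q.2 else q.2 <= p.2) ->
    domain T q.
  have [a aT /andP[/= h1 h2]] := pT i j.
  exists (Num.min (if i then rs1 a - p.1 else p.1 - rs0 a)
                  (if j then rt1 a - p.2 else p.2 - rt0 a)).
    by rewrite lt_min; case: i j h1 h2 => -[] /andP[? ?] /andP[? ?]; apply/andP; split; lra.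
  move=> q pq pq1 pq2; exists a => //; apply/(@rect_setP _ true).
    have := pq true; rewrite lt_min ltr_norml => /andP[+ _].
    by case: (i) h1 pq1 => /andP[? ?] ? /andP[? ?]; apply/andP; split; rewrite /=; lra.
  have := pq false; rewrite lt_min !ltr_norml => /andP[_ +].
  by case: (j) h2 pq2 => /andP[? ?] ? /andP[? ?]; apply/andP; split; rewrite /=; lra.
have [e1 e10 h1] := quad true true; have [e2 e20 h2] := quad true false.
have [e3 e30 h3] := quad false true; have [e4 e40 h4] := quad false false.
apply/nbhs_box; exists (Num.min (Num.min e1 e2) (Num.min e3 e4)).
  by rewrite !lt_min e10 e20 e30 e40.
move=> q pq.
have {}pq d : [&& `|axis d p - axis d q| < e1, `|axis d p - axis d q| < e2,
   `|axis d p - axis d q| < e3 & `|axis d p - axis d q| < e4].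
  by have := pq d; rewrite !lt_min -!andbA.
by have [p1|/ltW p1] := leP p.1 q.1; have [p2|/ltW p2] := leP p.2 q.2;
  [apply: h1|apply: h2|apply: h3|apply: h4] => // d; have /and4P[] := pq d.
Qed.

Hypothesis meshT : is_tmesh T.

Lemma rlo_lt_rhi d a : a \in cells T -> rlo d a < rhi d a.
Proof. by move=> /(cells_nondeg meshT)[]; case: d. Qed.

Lemma cells_overlap a b : a \in cells T -> b \in cells T ->
  (forall d, rlo d a < rhi d b /\ rlo d b < rhi d a) -> a = b.
Proof.
move=> aT bT ab; apply/eqP/negPn/negP => /(cells_disjoint meshT aT bT) dis.
(* The midpoints of the overlaps in the two directions form a point inner to both cells. *)
pose c d := (Num.max (rlo d a) (rlo d b) + Num.min (rhi d a) (rhi d b)) / 2.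
have cP d : Num.max (rlo d a) (rlo d b) < c d < Num.min (rhi d a) (rhi d b).
  have [h1 h2] := ab d; have := rlo_lt_rhi d aT; have := rlo_lt_rhi d bT.
  move=> h3 h4; have h : Num.max (rlo d a) (rlo d b) < Num.min (rhi d a) (rhi d b).
    by rewrite lt_min !gt_max h1 h2 h3 h4.
  by rewrite !midf_lt.
suff : ((rect_set a)° `&` (rect_set b)°) (c true, c false) by rewrite dis.
by split; apply: inner_interior => d; have := cP d; rewrite gt_max lt_min;
  case: d => /= /andP[/andP[h1 h2] /andP[h3 h4]]; apply/andP.
Qed.

Lemma edge_in_cell e p : e \in edges T -> seg_set e p ->
  exists a, [/\ a \in cells T, rect_set a p & ~ inner a p].
Proof. by move=> eT /(edges_sub meshT eT)[a aT /frontier_rectE[? ?]]; exists a. Qed.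

Lemma coversP d i j p a : a \in cells T -> rside (~~ d) j a = axis (~~ d) p ->
  inhalf i (rlo d a) (axis d p) (rhi d a) -> covers d i j p a.
Proof.
move=> aT ja ia; rewrite /covers ia/=; have := rlo_lt_rhi (~~ d) aT.
by move: ja; rewrite /rside /inhalf; case: j => <- ->; rewrite lexx.
Qed.

(** A point of the side slightly beyond [p] lies on an edge contained in the frontier of [a]. This
    edge runs along the side, since a transverse one would have the germ [y] as its constant
    coordinate. *)
Lemma side_edge d i j a p : a \in cells T -> rside (~~ d) j a = axis (~~ d) p ->
  inhalf i (rlo d a) (axis d p) (rhi d a) ->
  exists e, [/\ e \in edges T, horiz e = d, cor e = axis (~~ d) p,
    inhalf i (lo e) (axis d p) (hi e) & rlo d a <= lo e /\ hi e <= rhi d a].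
Proof.
move=> aT ja ia; have [y gy _] := exists_germ coords i (axis d p) ltr01.
have yin := (gy.2 _ _ (coords_rlo d aT) (coords_rhi d aT)).2 ia.
have : frontier (rect_set a) (pt d y (axis (~~ d) p)).
  apply/frontier_rectE; split.
    apply: (@rect_setP _ d); rewrite axisE.
      by have /andP[/ltW -> /ltW ->] := yin.
    by have /andP[_ /inhalfW] := coversP aT ja ia.
  move=> /(_ (~~ d)); rewrite axisE -ja /rside.
  by case: (j); rewrite ltxx ?andbF.
have [F FT Fa] := cell_boundary meshT aT; rewrite Fa => -[e eF /seg_setE[e1 e2]].
have eT : e \in edges T := FT _ eF; have [cT lT hT] := coords_edge eT.
have hd : horiz e = d.
  apply/eqP; rewrite -[_ == _]negbK; apply/negP => ed; apply: (germ_neq gy cT).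
  rewrite -e2 (_ : ~~ horiz e = d) ?axisE//.
  by move: ed; case: (horiz e) (d) => -[].
rewrite hd !axisE in e1 e2.
have sub p' : seg_set e p' -> rect_set a p'.
  by move=> ep'; suff /frontier_rectE[] : frontier (rect_set a) p' by []; rewrite Fa; exists e.
have le := edges_nondeg meshT eT.
exists e; split => //; first exact: (gy.2 _ _ lT hT).1 e1.
have /sub/rect_setE/(_ d) : seg_set e (start e).
  by apply/seg_setE; rewrite startE !axisE lexx ltW.
have /sub/rect_setE/(_ d) : seg_set e (stop e).
  by apply/seg_setE; rewrite stopE !axisE lexx ltW.
by rewrite startE stopE hd !axisE => /andP[_ ->] /andP[-> _].
Qed.

Lemma endpoint_vertex i e : e \in edges T -> endpoint i e \in vertices T.
Proof.
move=> eT; rewrite inE; apply/orP; case: i; [left|right]; exact: in_imfset.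
Qed.

(** The edge given by [side_edge] does not extend beyond the side of [a], so it ends exactly at the
    corner. *)
Lemma corner_has_edge d i j a : a \in cells T -> has_edge d i (corner d i j a).
Proof.
move=> aT; have al := rlo_lt_rhi d aT.
have [||e [eT hd ce ie [h1 h2]]] := @side_edge d i j a (corner d i j a) aT.
- by rewrite axisE.
- by rewrite axisE /rside /inhalf; case: i; rewrite lexx al.
exists e; split=> //; apply: (@axisP _ d); last by rewrite axisN_endpoint.
rewrite axis_endpoint// axisE; move: ie; rewrite axisE /rside /inhalf.
by case: (i) => /andP[h3 h4]; apply/eqP; rewrite eq_le ?h1 ?h2 ?h3 ?h4.
Qed.

Lemma corner_vertex d i j a : a \in cells T -> corner d i j a \in vertices T.
Proof. by move=> /(corner_has_edge d i j)[e [eT _ <-]]; exact: endpoint_vertex. Qed.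

End Cover.

(** * Edges and the cells beside them in a reduced T-mesh *)

Section Reduced.
Variables (R : realType) (T : premesh R).
Hypotheses (meshT : is_tmesh T) (redT : reduced T).
Implicit Types (a b : rect R) (e f rho eta : seg R) (u v w p q : R * R).
Implicit Types (d i j : bool) (x y l c : R).

Lemma vertex_in_edge e v : e \in edges T -> v \in vertices T -> seg_set e v ->
  exists i, v = endpoint i e.
Proof.
move=> /(edges_consecutive redT)[rho [_ _ _ E]] vT ev.
have : (seg_set e `&` [set` vertices T]) v by [].
by rewrite E => -[->|->]; [exists true|exists false].
Qed.

Lemma seg_endpoint i e : e \in edges T -> seg_set e (endpoint i e).
Proof.
move=> /(edges_nondeg meshT) le; apply/seg_setE; rewrite axisN_endpoint//.
by rewrite axis_endpoint//; case: i; rewrite lexx ltW.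
Qed.

(* An edge at [v] starting in direction [i] has [v] as endpoint: no vertex
   lies in the relative interior of an edge. *)
Lemma has_edgeP d i v e : v \in vertices T -> e \in edges T -> horiz e = d ->
  cor e = axis (~~ d) v -> inhalf i (lo e) (axis d v) (hi e) -> endpoint i e = v.
Proof.
move=> vT eT ed ce ie.
have [|k vk] := @vertex_in_edge e v eT vT.
  by apply/seg_setE; rewrite ed (inhalfW ie).
move: ie; rewrite vk axis_endpoint// /inhalf.
by case: k i {vk} => -[]; rewrite ?ltxx ?andbF.
Qed.

(** The edge cannot pass through the interior of [b], because edges lie on frontiers of cells. It
    cannot outrun the side of [b] either, because corners are vertices and no vertex lies inside an
    edge. *)
Lemma covers_flanks d i j p e b : e \in edges T -> b \in cells T -> horiz e = d ->
  cor e = axis (~~ d) p -> inhalf i (lo e) (axis d p) (hi e) ->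
  covers d i j p b -> flanks j e b.
Proof.
move=> eT bT ed ep ie /andP[ib jb].
have [cT lT hT] := coords_edge eT.
have [y gy _] := exists_germ (coords T) i (axis d p) ltr01.
have ye := (gy.2 _ _ lT hT).2 ie.
have yb := (gy.2 _ _ (coords_rlo d bT) (coords_rhi d bT)).2 ib.
have eq : seg_set e (pt d y (cor e)).
  by apply/seg_setE; rewrite ed !axisE; case/andP: ye => /ltW -> /ltW ->.
have cb : cor e = rside (~~ d) j b.
  apply/eqP/negPn/negP => cb.
  have {}jb : rlo (~~ d) b < cor e < rhi (~~ d) b.
    move: cb jb; rewrite ep /rside /inhalf.
    case: (j) => cb /andP[h1 h2]; apply/andP; split=> //.
      by rewrite lt_neqAle eq_sym cb.
    by rewrite lt_neqAle cb.
  (* A point of [e] inner to [b] also lies on the frontier of some cell [c]; then [b] and [c]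
     overlap and coincide, which is absurd. *)
  have qb : inner b (pt d y (cor e)) by apply: (@innerP _ d); rewrite axisE.
  have [c [cT' /rect_setE qc nqc]] := edge_in_cell meshT eT eq.
  suff bc : b = c by rewrite -bc in nqc.
  apply: (cells_overlap meshT) => // d'.
  have [->|->] : d' = d \/ d' = ~~ d by case: (d') (d) => -[]; auto.
    have := qc d; rewrite axisE => /(gy.2 _ _ (coords_rlo d cT') (coords_rhi d cT')).1.
    move=> /(gy.2 _ _ (coords_rlo d cT') (coords_rhi d cT')).2.
    by case/andP: yb; lra.
  have := qc (~~ d); rewrite axisE; have := rlo_lt_rhi meshT (~~ d) cT'.
  by case/andP: jb; lra.
split; rewrite ed//.
  (* If [e] extended beyond a corner of [b], that corner would be a vertex in the relative interior
     of [e]. *)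
  rewrite leNgt; apply/negP => le.
  have [||k /(congr1 (axis d))] := @vertex_in_edge e (corner d true j b) eT.
  - exact: corner_vertex.
  - apply/seg_setE; rewrite ed !axisE cb; split=> //; rewrite /rside (ltW le)/=.
    by case/andP: ye; case/andP: yb; lra.
  rewrite axisE axis_endpoint// /rside; case: k => h; first by rewrite h ltxx in le.
  by case/andP: ye; case/andP: yb; rewrite h; lra.
rewrite leNgt; apply/negP => le.
have [||k /(congr1 (axis d))] := @vertex_in_edge e (corner d false j b) eT.
- exact: corner_vertex.
- apply/seg_setE; rewrite ed !axisE cb; split=> //; rewrite /rside (ltW le) andbT.
  by case/andP: ye; case/andP: yb; lra.
rewrite axisE axis_endpoint// /rside; case: k => h; last by rewrite h ltxx in le.
by case/andP: ye; case/andP: yb; rewrite h; lra.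
Qed.

Lemma flanks_covers d i j p e b : b \in cells T -> horiz e = d ->
  cor e = axis (~~ d) p -> inhalf i (lo e) (axis d p) (hi e) ->
  flanks j e b -> covers d i j p b.
Proof.
move=> bT ed ep ie [h1 h2 h3]; apply: (coversP meshT bT); first by rewrite -ep -ed.
rewrite ed in h2 h3; move: ie; rewrite /inhalf.
by case: i => /andP[h4 h5]; apply/andP; split; lra.
Qed.

(** Only one side mentions [p]: coverage beside an edge is the same at all its points. *)
Lemma flanked_cov d i j p e : e \in edges T -> horiz e = d ->
  cor e = axis (~~ d) p -> inhalf i (lo e) (axis d p) (hi e) ->
  flanked T j e <-> cov T d i j p.
Proof.
move=> eT ed ep ie; split=> -[b bT eb]; exists b => //.
  exact: flanks_covers eb.
exact: covers_flanks eb.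
Qed.

Lemma edge_flanked e : e \in edges T -> exists j, flanked T j e.
Proof.
move=> eT; have [cT lT hT] := coords_edge eT; set d := horiz e.
have [y gy _] := exists_germ (coords T) true (lo e) ltr01.
have le := edges_nondeg meshT eT.
have ie : inhalf true (lo e) (lo e) (hi e) by rewrite /inhalf lexx.
have ye := (gy.2 _ _ lT hT).2 ie.
have eq : seg_set e (pt d y (cor e)).
  by apply/seg_setE; rewrite !axisE; case/andP: ye => /ltW -> /ltW ->.
have [a [aT /rect_setE qa _]] := edge_in_cell meshT eT eq.
(* The cell extends to the positive side of [e] unless [e] lies on its high side. *)
exists (cor e < rhi (~~ d) a); exists a => //.
apply: (covers_flanks (d := d) (i := true) (p := pt d (lo e) (cor e))) => //;
  rewrite ?axisE//.
rewrite /covers !axisE; apply/andP; split.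
  by apply: (gy.2 _ _ (coords_rlo d aT) (coords_rhi d aT)).1; move: (qa d); rewrite axisE.
have := qa (~~ d); rewrite axisE; have := rlo_lt_rhi meshT (~~ d) aT.
rewrite /inhalf; by case: (ltP (cor e)) => h1 h2 /andP[h3 h4]; apply/andP; split; lra.
Qed.

Lemma int_edgeP e : e \in edges T ->
  e \in int_edges T <-> forall j, flanked T j e.
Proof.
move=> eT; have le := edges_nondeg meshT eT.
rewrite !inE eT/=; split=> [/asboolP[p [/seg_setE[ep1 ep2] /int_cov pT]] j|eF].
  have {ep1}[i ie] : exists i, inhalf i (lo e) (axis (horiz e) p) (hi e).
    exists (axis (horiz e) p < hi e); rewrite /inhalf; move: ep1.
    by case: ltP => [? /andP[-> _]//|h /andP[_ ->]]; rewrite andbT (lt_le_trans le).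
  apply: (flanked_cov j eT erefl (esym ep2) ie).2.
  by case: (horiz e) ie; first by []; rewrite -covC.
(* At the midpoint [e] continues in both directions, so the cells on its two sides cover all four
   quadrants. *)
have /andP[m1 m2] : lo e < (lo e + hi e) / 2 < hi e by rewrite !midf_lt.
apply/asboolP; exists (pt (horiz e) ((lo e + hi e) / 2) (cor e)); split.
  by apply/seg_setE; rewrite !axisE !ltW.
apply/int_cov => i j;
  have H i' j' : cov T (horiz e) i' j' (pt (horiz e) ((lo e + hi e) / 2) (cor e)).
  apply: (flanked_cov j' (e := e) eT erefl _ _).1 => //; rewrite ?axisE//.
  by apply: inhalf_strict; rewrite m1 m2.
by case: (horiz e) H => H; [exact: H|rewrite -covC; exact: H].
Qed.

(** If [a] stopped at the line through [v] in direction [d], its side would contain an edge leaving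
    [v] in direction [i]. *)
Lemma covers_flip d i j v a : v \in vertices T -> a \in cells T ->
  ~ has_edge T d i v -> covers d i j v a -> covers d i (~~ j) v a.
Proof.
move=> vT aT nv /[dup] cva /andP[ia ja].
have [E|E] := eqVneq (rside (~~ d) j a) (axis (~~ d) v).
  case: nv; have [e [eT ed ce ie _]] := side_edge meshT aT E ia.
  by exists e; split=> //; exact: (has_edgeP vT eT ed ce ie).
rewrite /covers ia/=; move: ja E; rewrite /inhalf /rside; case: (j) => /andP[h1 h2] E /=.
  by rewrite lt_neqAle E h1 ltW.
by rewrite lt_neqAle eq_sym E h2 ltW.
Qed.

Lemma corner_covers i j a : a \in cells T -> covers true i j (corner true i j a) a.
Proof.
move=> aT; have h1 := rlo_lt_rhi meshT true aT; have h2 := rlo_lt_rhi meshT false aT.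
rewrite /covers /corner !axisE /rside /inhalf /=.
by case: i j => -[]; rewrite ?lexx ?h1 ?h2.
Qed.

(** A cell covering the quadrant between two perpendicular edges flanks both of them, and this fixes
    the two sides meeting at its corner. *)
Lemma is_cornerP i j v : v \in vertices T ->
  (exists2 a, a \in cells T & corner true i j a = v) <->
  [/\ has_edge T true i v, has_edge T false j v & cov T true i j v].
Proof.
move=> vT; split=> [[a aT <-]|[[e [eT ed ev]] [f [fT fd fv]] [a aT va]]].
  split; [exact: corner_has_edge| |by exists a; last exact: corner_covers].
  have := corner_has_edge meshT false j i aT.
  by rewrite /corner /pt.
have ie g k : g \in edges T -> inhalf k (lo g) (axis (horiz g) (endpoint k g)) (hi g).
  move=> /(edges_nondeg meshT) lg; rewrite axis_endpoint// /inhalf.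
  by case: k; rewrite lexx lg.
exists a => //.
have [e1 _ _] : flanks j e a.
  by apply: (covers_flanks eT aT ed _ _ va); rewrite -ev ?axisN_endpoint// -ed; exact: ie.
have [f1 _ _] : flanks i f a.
  apply: (covers_flanks fT aT fd (p := v) (i := j)).
  - by rewrite -fv axisN_endpoint.
  - by rewrite -fv -fd; exact: ie.
  by rewrite -[covers _ _ _ _ _]coversC.
rewrite ed in e1; rewrite fd in f1.
apply: (@axisP _ true); rewrite /corner !axisE.
  by have := axisN_endpoint j fd; rewrite fv f1.
by have := axisN_endpoint i ed; rewrite ev e1.
Qed.

End Reduced.

(** * Maximal segments and corner count *)

Section MaximalSegments.
Variables (R : realType) (T : premesh R).
Hypotheses (meshT : is_tmesh T) (redT : reduced T).
Implicit Types (a b : rect R) (e f rho eta : seg R) (u v w p q : R * R).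
Implicit Types (d i j : bool) (x y l c : R).

Lemma seg_subP e rho : lo e < hi e -> seg_set e `<=` seg_set rho ->
  [/\ horiz e = horiz rho, cor e = cor rho, lo rho <= lo e & hi e <= hi rho].
Proof.
move=> le er.
have /er/seg_setE[s1 s2] : seg_set e (start e).
  by apply/seg_setE; rewrite startE !axisE lexx ltW.
have /er/seg_setE[t1 t2] : seg_set e (stop e).
  by apply/seg_setE; rewrite stopE !axisE lexx ltW.
have hh : horiz rho = horiz e.
  have [//|h] := eqVneq (horiz rho) (horiz e).
  have {}h : ~~ horiz rho = horiz e by case: (horiz rho) (horiz e) h => -[].
  by move: s2 t2 le; rewrite startE stopE h !axisE => -> ->; rewrite ltxx.
move: s1 s2 t1 t2; rewrite startE stopE hh !axisE.
by move=> /andP[? _] ? /andP[_ ?] _; split.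
Qed.

Lemma MShat_MS rho : MShat T rho -> MS T rho \/ BMS T rho.
Proof. by move=> [[[[? _ _]|[? _]]|[? _]]|?]; [left|left|left|right]. Qed.

Lemma MShat_lt rho : MShat T rho -> lo rho < hi rho.
Proof. by move=> /MShat_MS[[[]]|[[]]]. Qed.

Lemma MShat_edge rho p : MShat T rho -> seg_set rho p ->
  exists e, [/\ e \in edges T, seg_set e `<=` seg_set rho & seg_set e p].
Proof.
have sub E : E `<=` [set` edges T] -> (exists2 F : set (seg R), F `<=` E &
    seg_set rho = \bigcup_(e in F) seg_set e) -> seg_set rho p ->
  exists e, [/\ e \in edges T, seg_set e `<=` seg_set rho & seg_set e p].
  move=> ET [F FE ->] [e Fe ep]; exists e; split=> //; first exact/ET/FE.
  by move=> q eq; exists e.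
move=> /MShat_MS[[[_ rF] _]|[[_ rF] _]]; apply: sub rF => e /=; rewrite !inE => /andP[]//.
Qed.

(** A point of [e] just after its start lies on some [f] in [E]. If [f] differed from [e], this
    point would be a vertex inside [e]. *)
Lemma edge_of_segment (E : {fset seg R}) rho e : {subset E <= edges T} ->
  segment_of E rho -> e \in edges T -> seg_set e `<=` seg_set rho -> e \in E.
Proof.
move=> ET [_ [F FE rhoF]] eT er; have [cT lT hT] := coords_edge eT.
have le := edges_nondeg meshT eT.
have [y gy _] := exists_germ (coords T) true (lo e) ltr01.
have ie : inhalf true (lo e) (lo e) (hi e) by rewrite /inhalf lexx.
have ye := (gy.2 _ _ lT hT).2 ie.
have eq : seg_set e (pt (horiz e) y (cor e)).
  by apply/seg_setE; rewrite !axisE; case/andP: ye => /ltW -> /ltW ->.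
have := er _ eq; rewrite rhoF => -[f Ff fq]; have fE : f \in E := FE _ Ff.
have [->//|ef] := eqVneq e f.
have qT := edges_meet meshT eT (ET _ fE) ef (conj eq fq).
have [k /(congr1 (axis (horiz e)))] := vertex_in_edge redT eT qT eq.
by rewrite axisE axis_endpoint//; case: k => h; move: ye; rewrite h ltxx ?andbF.
Qed.

Lemma int_edge_MShat rho e : MShat T rho -> e \in edges T ->
  seg_set e `<=` seg_set rho -> e \in int_edges T <-> ~ BMS T rho.
Proof.
move=> rT eT er; split=> [ei [rb _]|nb].
  suff : e \in bnd_edges T by move: ei; rewrite !inE eT/= => ->.
  by apply: edge_of_segment rb eT er => f; rewrite !inE => /andP[].
case: (MShat_MS rT) => // -[rm _]; apply: edge_of_segment rm _ _ => //.
by move=> f; rewrite !inE => /andP[].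
Qed.

Lemma exists_through v d : v \in vertices T ->
  exists! rho, [/\ MShat T rho, horiz rho = d & seg_set rho v].
Proof.
case: d => vT.
  have [rho [[r1 r2 r3] ru]] := vertex_hseg redT vT.
  by exists rho; split=> // eta [e1 e2 e3]; apply: ru; rewrite e2.
have [rho [[r1 r2 r3] ru]] := vertex_vseg redT vT.
exists rho; split; first by split=> //; exact: negbTE.
by move=> eta [e1 e2 e3]; apply: ru; rewrite e2.
Qed.

Definition through d v : seg R := xget (Seg true 0 0 0)
  [set rho | [/\ MShat T rho, horiz rho = d & seg_set rho v]].

Lemma throughP d v : v \in vertices T ->
  [/\ MShat T (through d v), horiz (through d v) = d & seg_set (through d v) v].
Proof.
by move=> /(exists_through d)[rho [rP _]]; rewrite /through; case: xgetP => // /(_ rho).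
Qed.

Lemma through_uniq d v rho : v \in vertices T -> MShat T rho -> horiz rho = d ->
  seg_set rho v -> through d v = rho.
Proof.
move=> vT r1 r2 r3; have [eta [_ ru]] := exists_through d vT.
by rewrite -(ru rho)//; rewrite (ru (through d v))//; exact: throughP.
Qed.

Lemma axis_through d v : v \in vertices T -> axis d v = cor (through (~~ d) v).
Proof.
move=> /(throughP (~~ d))[_ h /seg_setE[_ <-]].
by rewrite h negbK.
Qed.

Lemma edge_sub_through i e : e \in edges T ->
  seg_set e `<=` seg_set (through (horiz e) (endpoint i e)).
Proof.
move=> eT; have [rho [r1 _ r2 _]] := (edges_consecutive redT e).1 eT.
have [h _ _ _] := seg_subP (edges_nondeg meshT eT) r2.
rewrite (@through_uniq _ _ rho) ?endpoint_vertex//.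
by apply: r2; apply: (seg_endpoint meshT).
Qed.

Lemma endpoint_MShat i rho : MShat T rho -> endpoint i rho \in vertices T.
Proof.
move=> rT; have lr := MShat_lt rT.
have rp : seg_set rho (endpoint i rho).
  apply/seg_setE; rewrite axisN_endpoint// axis_endpoint//.
  by case: i; rewrite lexx ltW.
have [e [eT er ep]] := MShat_edge rT rp.
have [h1 h2 h3 h4] := seg_subP (edges_nondeg meshT eT) er.
suff -> : endpoint i rho = endpoint i e by exact: endpoint_vertex.
move: ep => /seg_setE[]; rewrite h1 axisN_endpoint// axis_endpoint// => /andP[e1 e2] _.
apply: (@axisP _ (horiz rho)); last by rewrite !axisN_endpoint.
rewrite !axis_endpoint//.
by case: (i) e1 e2 => e1 e2; apply: le_anti; rewrite ?h3 ?h4 ?e1 ?e2.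
Qed.

Lemma MShat_half rho i p : MShat T rho -> seg_set rho p ->
  inhalf i (lo rho) (axis (horiz rho) p) (hi rho) ->
  exists e, [/\ e \in edges T, horiz e = horiz rho, cor e = axis (~~ horiz rho) p &
    inhalf i (lo e) (axis (horiz rho) p) (hi e)].
Proof.
move=> rT /seg_setE[_ rp] ir.
(* The ends of [rho] are added to the list so that the germ also stays inside [rho]. *)
have [y gy _] := exists_germ (lo rho :: hi rho :: coords T) i (axis (horiz rho) p) ltr01.
have : lo rho < y < hi rho by apply: (gy.2 _ _ _ _).2; rewrite ?inE ?eqxx ?orbT.
move=> /andP[/ltW y1 /ltW y2].
have [|e [eT er]] := MShat_edge (p := pt (horiz rho) y (cor rho)) rT.
  by apply/seg_setE; rewrite !axisE y1 y2.
have [h1 h2 h3 h4] := seg_subP (edges_nondeg meshT eT) er.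
move=> /seg_setE[]; rewrite h1 axisE => ye _; exists e; rewrite h1 h2 rp; split=> //.
have [cT lT hT] := coords_edge eT.
by apply: (gy.2 _ _ _ _).1; rewrite ?inE ?lT ?hT ?orbT.
Qed.

(** Of two overlapping collinear segments, the one starting later has its start on both. That start
    is a vertex, and only one maximal segment per direction passes through a vertex. *)
Lemma parallel_meet rho eta p : MShat T rho -> MShat T eta ->
  horiz rho = horiz eta -> seg_set rho p -> seg_set eta p -> rho = eta.
Proof.
wlog le : rho eta / lo rho <= lo eta => [wl|] rT eT h rp ep.
  have [/wl H|/ltW/wl H] := leP (lo rho) (lo eta); first exact: H.
  by apply/esym/H.
have vT := endpoint_MShat true eT.
move: (rp) (ep) => /seg_setE[r1 r2] /seg_setE[e1 e2].
rewrite -(@through_uniq (horiz rho) _ rho vT)//; last first.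
  apply/seg_setE; rewrite h axis_endpoint// axisN_endpoint// -e2 -h r2; split=> //.
  by rewrite le/=; move: r1 e1; rewrite h => /andP[_ ?] /andP[? _]; lra.
apply: through_uniq => //; apply/seg_setE.
by rewrite axis_endpoint// axisN_endpoint// lexx ltW// MShat_lt.
Qed.

Lemma cross_vertex rho eta p : MShat T rho -> MShat T eta ->
  horiz rho <> horiz eta -> seg_set rho p -> seg_set eta p -> p \in vertices T.
Proof.
move=> rT eT h rp ep.
have [e [e1 e2 e3]] := MShat_edge rT rp; have [f [f1 f2 f3]] := MShat_edge eT ep.
have [he _ _ _] := seg_subP (edges_nondeg meshT e1) e2.
have [hf _ _ _] := seg_subP (edges_nondeg meshT f1) f2.
apply: (edges_meet meshT e1 f1 _ (conj e3 f3)).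
by apply/eqP => ef; apply: h; rewrite -he -hf ef.
Qed.

(** * Coverage of the quadrants at a vertex *)

Lemma vertex_has_edge d v : v \in vertices T -> exists i, has_edge T d i v.
Proof.
move=> vT; have [h1 h2 h3] := throughP d vT; have l := MShat_lt h1.
have [i ie] : exists i, inhalf i (lo (through d v)) (axis d v) (hi (through d v)).
  exists (axis d v < hi (through d v)); rewrite /inhalf; move: h3 => /seg_setE[+ _].
  rewrite h2; case: ltP => [? /andP[-> _]//|h /andP[_ ->]].
  by rewrite andbT (lt_le_trans l).
rewrite -[X in axis X]h2 in ie; have [e [eT ed ce ie']] := MShat_half h1 h3 ie.
rewrite h2 in ed ce ie'; exists i; exists e; split=> //.
exact: (has_edgeP redT vT eT ed ce ie').
Qed.

(** An interior edge has cells on both sides and a boundary edge on exactly one; the type of the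
    edge is that of the maximal segment containing it. *)
Lemma has_edge_cov d i v : v \in vertices T -> has_edge T d i v ->
  if `[< BMS T (through d v) >] then cov T d i true v <-> ~ cov T d i false v
  else forall j, cov T d i j v.
Proof.
move=> vT [e [eT ed ev]].
have ie : inhalf i (lo e) (axis d v) (hi e).
  rewrite -ev axis_endpoint// /inhalf.
  by have := edges_nondeg meshT eT; case: (i) => ->; rewrite lexx.
have ce : cor e = axis (~~ d) v by rewrite -ev axisN_endpoint.
have F j := flanked_cov meshT redT j eT ed ce ie.
have [h1 _ _] := throughP d vT.
have es := @edge_sub_through i e eT; rewrite ed ev in es.
have IB := int_edge_MShat h1 eT es; have IF := int_edgeP meshT redT eT.
case: asboolP => [hb|nb]; last by move=> j; apply/F; move: j; apply/IF/IB.
have nI : ~ (forall j, flanked T j e) by move=> /IF/IB.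
rewrite -!F; split=> [t f|nf]; first by apply: nI => -[].
by have [[]] := edge_flanked meshT redT eT.
Qed.

Lemma no_edge_cov d i j v : v \in vertices T -> ~ has_edge T d i v ->
  cov T d i j v -> cov T d i (~~ j) v.
Proof.
move=> vT nv [a aT va]; exists a => //; exact: (covers_flip meshT redT vT aT nv va).
Qed.

(** With neither bounding edge present, the cell extends across both lines through [v], hence into
    the opposite quadrant. *)
Lemma reentrant_cov i j v : v \in vertices T -> ~ has_edge T true i v ->
  ~ has_edge T false j v -> cov T true i j v -> cov T true (~~ i) (~~ j) v.
Proof.
move=> vT ni nj [a aT va]; exists a => //.
have /andP[_ h1] := covers_flip meshT redT vT aT ni va.
have /andP[_ h2] : covers false j (~~ i) v a.
  by apply: (covers_flip meshT redT vT aT nj); rewrite -coversC.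
by apply/andP.
Qed.

Lemma int_vertexP v : v \in vertices T ->
  v \in int_vertices T <-> forall d, ~ BMS T (through d v).
Proof.
move=> vT; move: (vT); rewrite !inE => -> /=; split=> [/asboolP vi d hb|nb].
  have [h1 h2 h3] := throughP d vT; have [e [e1 e2 e3]] := MShat_edge h1 h3.
  suff /(int_edge_MShat h1 e1 e2) : e \in int_edges T by [].
  by rewrite !inE e1/=; apply/asboolP; exists v.
(* Coverage passes across each half-line at [v]: an edge there is interior and has cells on both
   sides, and where there is no edge the covering cell itself extends across. Starting from one
   edge, all four quadrants are reached. *)
have flip d i j : cov T d i j v -> cov T d i (~~ j) v.
  have [hv|] := pselect (has_edge T d i v); last exact: no_edge_cov.
  by have := has_edge_cov vT hv; case: asboolP => [/nb//|_].
have [i hv] := vertex_has_edge true vT.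
have ci j : cov T true i j v by have := has_edge_cov vT hv; case: asboolP => [/nb//|_].
have cNi j : cov T true (~~ i) j v by rewrite -covC; apply: flip; rewrite covC.
apply/asboolP/int_cov => k j.
by have [->|->] : k = i \/ k = ~~ i by case: (k) (i) => -[]; auto.
Qed.

(** * Counting cells by their corners *)

Definition num_corners v : nat :=
  (let H d i := `[< has_edge T d i v >] in
  if [&& `[< BMS T (through true v) >], `[< BMS T (through false v) >],
    H true true, H true false, H false true & H false false] then 2
  else (H true true + H true false) * (H false true + H false false))%N.

Definition is_corner v i j : bool := `[< exists2 a, a \in cells T & corner true i j a = v >].

(* At a vertex, [c11], ..., [c00] tell which quadrants are covered, [h], [h']
   (resp. [w], [w']) which horizontal (resp. vertical) edges exist and [b]
   (resp. [b']) whether these are boundary edges.  The coverage changes exactly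
   across boundary edges; the four hypotheses [c11 ==> c00], ... exclude
   reentrant corners. *)
Lemma quadrant_count (h h' w w' c11 c10 c01 c00 b b' : bool) :
  h ==> (if b then c11 (+) c10 else c11 && c10) ->
  h' ==> (if b then c01 (+) c00 else c01 && c00) ->
  w ==> (if b' then c11 (+) c01 else c11 && c01) ->
  w' ==> (if b' then c10 (+) c00 else c10 && c00) ->
  h || (c11 == c10) -> h' || (c01 == c00) ->
  w || (c11 == c01) -> w' || (c10 == c00) ->
  [|| h, w | c11 ==> c00] -> [|| h, w' | c10 ==> c01] ->
  [|| h', w | c01 ==> c10] -> [|| h', w' | c00 ==> c11] ->
  h || h' -> w || w' ->
  ([&& h, w & c11] + [&& h, w' & c10] + [&& h', w & c01] + [&& h', w' & c00] =
   if [&& b, b', h, h', w & w'] then 2 else (h + h') * (w + w'))%N.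
Proof.
by case: h; case: h'; case: w; case: w'; case: c11; case: c10; case: c01;
  case: c00; case: b; case: b'.
Qed.

Lemma num_cornersE v : v \in vertices T ->
  (is_corner v true true + is_corner v true false
   + is_corner v false true + is_corner v false false = num_corners v)%N.
Proof.
move=> vT; pose H d i := `[< has_edge T d i v >].
pose C i j := `[< cov T true i j v >].
have E i j : is_corner v i j = [&& H true i, H false j & C i j].
  by apply/asboolP/and3P => [/(is_cornerP meshT redT i j vT)[? ? ?]|[? ? ?]];
    [split; apply/asboolP|apply/(is_cornerP meshT redT i j vT); split; apply/asboolP].
set b1 := `[< BMS T (through true v) >]; set b2 := `[< BMS T (through false v) >].
have XP (A B : Prop) : (A <-> ~ B) -> `[< A >] (+) `[< B >].
  by move=> h; rewrite (asbool_equiv_eq h) asbool_neg addNb addbb.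
have P1 i : H true i ==> if b1 then C i true (+) C i false else C i true && C i false.
  apply/implyP => /asboolP/(has_edge_cov vT); rewrite -/b1 /C; case: b1 => h; first exact: XP.
  by apply/andP; split; exact/asboolP.
have CC i j : `[< cov T true i j v >] = `[< cov T false j i v >].
  exact/asbool_equiv_eq/(covC T false).
have P2 j : H false j ==> if b2 then C true j (+) C false j else C true j && C false j.
  apply/implyP => /asboolP/(has_edge_cov vT); rewrite -/b2 /C !CC.
  by case: b2 => h; [exact: XP|apply/andP; split; exact/asboolP].
have N1 i : H true i || (C i true == C i false).
  have [?|/= ni] := boolP (H true i) => //; apply/eqP/asbool_equiv_eq.
  by split; apply: (no_edge_cov vT) => /asboolP; exact/negP.
have N2 j : H false j || (C true j == C false j).
  have [?|/= nj] := boolP (H false j) => //; apply/eqP; rewrite /C !CC.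
  by apply/asbool_equiv_eq; split; apply: (no_edge_cov vT) => /asboolP; exact/negP.
have N3 i j : [|| H true i, H false j | C i j ==> C (~~ i) (~~ j)].
  have [?|ni] := boolP (H true i) => //; have [?|nj] := boolP (H false j) => //=.
  apply/implyP => /asboolP c; apply/asboolP.
  by apply: reentrant_cov => // /asboolP; apply/negP.
have X d : H d true || H d false.
  by have [[] h] := vertex_has_edge d vT; apply/orP; [left|right]; apply/asboolP.
by rewrite !E /num_corners; apply: quadrant_count;
  rewrite ?P1 ?P2 ?N1 ?N2 ?X ?(N3 true true) ?(N3 true false) ?(N3 false true).
Qed.

Lemma covers_inj i j p a b : a \in cells T -> b \in cells T ->
  covers true i j p a -> covers true i j p b -> a = b.
Proof.
move=> aT bT /andP[/= a1 a2] /andP[/= b1 b2]; apply: (cells_overlap meshT) => // d.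
have H l x c l' c' k : inhalf k l x c -> inhalf k l' x c' -> l < c' /\ l' < c :> R.
  by rewrite /inhalf; case: k => /andP[? ?] /andP[? ?]; split; lra.
by case: d; [exact: H a1 b1|exact: H a2 b2].
Qed.

(** For fixed [(i, j)] a cell is determined by its corner, since two cells occupying the same
    quadrant at a point overlap. *)
Lemma card_is_corner i j :
  (size (cells T) = \sum_(v <- vertices T) is_corner v i j)%N.
Proof.
transitivity (count (fun v => is_corner v i j) (vertices T)); last first.
  by rewrite -sum1_count big_mkcond; apply: eq_bigr => v _; case: is_corner.
rewrite -size_filter -(size_map (corner true i j)); apply: perm_size.
apply: uniq_perm => [||v].
- rewrite map_inj_in_uniq ?fset_uniq// => a b aT bT E.
  have := corner_covers meshT i j aT; rewrite E => /covers_inj; apply=> //.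
  exact: (corner_covers meshT).
- by rewrite filter_uniq// fset_uniq.
rewrite mem_filter; apply/mapP/andP => [[a aT ->]|[/asboolP[a aT <-] _]]; last by exists a.
by split; [apply/asboolP; exists a|exact: (corner_vertex meshT)].
Qed.

(** Summation of [card_is_corner] over the four kinds of corners. The right-hand side refers only to
    the edges at each vertex and to the type of its segments, which a structural isomorphism
    preserves. *)
Lemma card_cells : (4 * size (cells T) = \sum_(v <- vertices T) num_corners v)%N.
Proof.
rewrite big_seq -(eq_bigr _ (fun v vT => num_cornersE vT)) -big_seq !big_split/=.
by rewrite -!card_is_corner !mulSn mul0n addn0 !addnA.
Qed.

End MaximalSegments.

(** * Structural isomorphisms *)

(** Expressed only through the maximal segments at vertices and the order of coordinates, the data
    that a structural isomorphism transports. *)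
Definition consecutive (R : realType) (T : premesh R) d (v w : R * R) :=
  [/\ through T d v = through T d w, axis d v < axis d w &
      forall u, u \in vertices T -> through T d u = through T d v ->
        ~ (axis d v < axis d u < axis d w)].

Lemma edge_consecutive (R : realType) (T : premesh R) e :
  is_tmesh T -> reduced T ->
  e \in edges T <-> [/\ start e \in vertices T, stop e \in vertices T &
    consecutive T (horiz e) (start e) (stop e)].
Proof.
move=> meshT redT; split=> [eT|[sT tT [st lt nb]]].
  have le := edges_nondeg meshT eT.
  have sT := endpoint_vertex true eT; have tT := endpoint_vertex false eT.
  have es : seg_set e `<=` seg_set (through T (horiz e) (start e)).
    exact: (@edge_sub_through _ _ meshT redT true e eT).
  have [h1 h2 h3] := throughP redT (horiz e) sT.
  split=> //; split.
  - apply/esym/(through_uniq redT) => //; apply: es.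
    exact: (seg_endpoint meshT false).
  - by rewrite startE stopE !axisE.
  move=> u uT us /andP[u1 u2].
  have [_ _ u3] := throughP redT (horiz e) uT.
  have eu : seg_set e u.
    move: u1 u2; rewrite startE stopE !axisE => u1 u2.
    apply/seg_setE; rewrite !ltW//; split=> //; rewrite (axis_through redT)// negbK us.
    by have [_ -> _ _] := seg_subP le es.
  have [k /(congr1 (axis (horiz e)))] := vertex_in_edge redT eT uT eu.
  by case: k => E; move: u1 u2; rewrite E ltxx.
apply/(edges_consecutive redT).
have [r1 r2 r3] := throughP redT (horiz e) sT.
have [_ _ r4] := throughP redT (horiz e) tT; rewrite -st in r4.
exists (through T (horiz e) (start e)).
move: lt; rewrite startE stopE !axisE -startE -stopE => lt.
have es : seg_set e `<=` seg_set (through T (horiz e) (start e)).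
  move: (through _ _ _) r2 r3 r4 => rho r2 r3 r4 p /seg_setE[/andP[p1 p2] p3].
  move: r3 r4 => /seg_setE + /seg_setE; rewrite r2 startE stopE !axisE.
  move=> [/andP[s1 _] s2] [/andP[_ s3] _].
  by apply/seg_setE; rewrite r2 p3 (le_trans s1 p1) (le_trans p2 s3).
split=> //; apply/seteqP; split=> [u [eu /= uT]|u [->|->]]; last 2 first.
- by split=> //; apply/seg_setE; rewrite startE !axisE lexx ltW.
- by split=> //; apply/seg_setE; rewrite stopE !axisE lexx ltW.
have us : through T (horiz e) u = through T (horiz e) (start e).
  by apply: through_uniq => //; exact: es.
move: (eu) => /seg_setE[/andP[u1 u2] u3].
have := nb u uT us; rewrite startE stopE !axisE => /negP.
rewrite negb_and -!leNgt => /orP[u4|u4]; [left|right];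
  apply: (@axisP _ (horiz e)); rewrite ?startE ?stopE !axisE //.
  by apply: le_anti; rewrite u4 u1.
by apply: le_anti; rewrite u4 u2.
Qed.

(** * Images of vertices and edges *)

Section Isomorphism.
Variables (R : realType) (T T' : premesh R) (alpha : seg R -> seg R).
Hypotheses (meshT : is_tmesh T) (redT : reduced T).
Hypotheses (meshT' : is_tmesh T') (redT' : reduced T').
Hypotheses (iso : structural_iso T T' alpha) (dir : direction_preserving T alpha).
Implicit Types (a b : rect R) (e f rho eta : seg R) (u v w p q : R * R).
Implicit Types (d i j : bool) (x y l c : R).

(** Explicit coordinates of $\alpha_0(v)$: the image of the vertical segment fixes $s$, that of the
    horizontal one fixes $t$. *)
Definition vertex_iso v : R * R :=
  pt true (cor (alpha (through T false v))) (cor (alpha (through T true v))).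

Lemma axis_vertex_iso d v : axis d (vertex_iso v) = cor (alpha (through T (~~ d) v)).
Proof. by case: d. Qed.

Lemma iso_MShat rho : MShat T rho -> MShat T' (alpha rho).
Proof. by have [f _ _] := iso_bij iso => /f. Qed.

Lemma iso_inj rho eta : MShat T rho -> MShat T eta -> alpha rho = alpha eta -> rho = eta.
Proof. by have [_ f _] := iso_bij iso => rT eT; apply: f; exact/mem_set. Qed.

Lemma iso_surj rho : MShat T' rho -> exists2 eta, MShat T eta & alpha eta = rho.
Proof. by have [_ _ f] := iso_bij iso => /f. Qed.

Lemma iso_BMSP rho : MShat T rho -> BMS T' (alpha rho) <-> BMS T rho.
Proof.
move=> rT; rewrite -(iso_BMS iso); split=> [[eta eb]|]; last by exists rho.
by move=> /iso_inj <-//; right.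
Qed.

Lemma vertex_iso_point v w : v \in vertices T ->
  (forall d, seg_set (alpha (through T d v)) w) -> w = vertex_iso v.
Proof.
move=> vT wv; apply: (@axisP _ true); rewrite axis_vertex_iso.
  have [h1 h2 _] := throughP redT false vT.
  by have /seg_setE[_ <-] := wv false; rewrite dir// h2.
have [h1 h2 _] := throughP redT true vT.
by have /seg_setE[_ <-] := wv true; rewrite dir// h2.
Qed.

(** The two segments through [v] meet, so their images meet; as direction is preserved, the constant
    coordinates leave only one possible point. *)
Lemma through_vertex_iso v : v \in vertices T -> vertex_iso v \in vertices T' /\
  forall d, through T' d (vertex_iso v) = alpha (through T d v).
Proof.
move=> vT; have [h1 h2 h3] := throughP redT true vT.
have [k1 k2 k3] := throughP redT false vT.
have ne : through T true v != through T false v.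
  by apply/eqP => E; move: h2; rewrite E k2.
have [|w [wh wk]] := (iso_meet iso h1 k1 ne).1; first by exists v.
have wd d : seg_set (alpha (through T d v)) w by case: d.
have E := vertex_iso_point vT wd; rewrite -E.
have wT : w \in vertices T'.
  apply: (cross_vertex meshT' (iso_MShat h1) (iso_MShat k1)) => //.
  by rewrite !dir// h2 k2.
split=> // d; have [r1 r2 r3] := throughP redT d vT.
by apply: through_uniq => //; [exact: iso_MShat|rewrite dir].
Qed.

Lemma vertex_iso_vertex v : v \in vertices T -> vertex_iso v \in vertices T'.
Proof. by case/through_vertex_iso. Qed.

Lemma through_inj v w : v \in vertices T -> w \in vertices T ->
  (forall d, through T d v = through T d w) -> v = w.
Proof.
by move=> vT wT vw; apply: (@axisP _ true); rewrite !(axis_through redT)// vw.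
Qed.

Lemma vertex_iso_inj v w : v \in vertices T -> w \in vertices T ->
  vertex_iso v = vertex_iso w -> v = w.
Proof.
move=> vT wT E; apply: through_inj => // d.
have [h1 _ _] := throughP redT d vT; have [k1 _ _] := throughP redT d wT.
apply: iso_inj => //; rewrite -(through_vertex_iso vT).2 E.
exact: (through_vertex_iso wT).2.
Qed.

Lemma vertex_iso_surj w : w \in vertices T' ->
  exists2 v, v \in vertices T & vertex_iso v = w.
Proof.
move=> wT; have [h1 h2 h3] := throughP redT' true wT.
have [k1 k2 k3] := throughP redT' false wT.
have [rho r1 r2] := iso_surj h1; have [eta e1 e2] := iso_surj k1.
rewrite -r2 in h2 h3; rewrite -e2 in k2 k3; rewrite !dir// in h2 k2.
have ne : rho != eta by apply/eqP => E; move: h2; rewrite E k2.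
have [|v [rv ev]] := (iso_meet iso r1 e1 ne).2; first by exists w.
have vT : v \in vertices T by apply: (cross_vertex meshT r1 e1) => //; rewrite h2 k2.
exists v => //; apply/esym/vertex_iso_point => // -[].
  by rewrite (through_uniq redT vT r1 h2 rv).
by rewrite (through_uniq redT vT e1 k2 ev).
Qed.

Lemma axis_vertex_iso_lt d v w : v \in vertices T -> w \in vertices T ->
  axis d v < axis d w <-> axis d (vertex_iso v) < axis d (vertex_iso w).
Proof.
move=> vT wT; rewrite !axis_vertex_iso !(axis_through redT)//.
have [h1 h2 _] := throughP redT (~~ d) vT; have [k1 k2 _] := throughP redT (~~ d) wT.
by apply: (iso_cor iso) => //; rewrite /parallel h2.
Qed.

(** Any pair chosen in [vertex_map] consists of the two segments through [v]: distinct segments that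
    meet are not parallel, and each direction has only one. *)
Lemma vertex_mapE v : v \in vertices T -> vertex_map T alpha v = vertex_iso v.
Proof.
move=> vT; have [h1 h2 h3] := throughP redT true vT.
have [k1 k2 k3] := throughP redT false vT.
have [wT wt] := through_vertex_iso vT.
rewrite /vertex_map; case: xgetP => [w _ [rho [eta [[r1 e1] ne rv aw]]]|no].
  have [rhov etav] : (seg_set rho `&` seg_set eta) v by rewrite rv.
  have [wr we] : (seg_set (alpha rho) `&` seg_set (alpha eta)) w by rewrite aw.
  have nh : horiz rho <> horiz eta.
    by move=> h; move/eqP: ne; apply; exact: (parallel_meet meshT redT r1 e1 h rhov etav).
  have tr := through_uniq redT vT r1 erefl rhov.
  have te := through_uniq redT vT e1 erefl etav.
  apply: vertex_iso_point => // d.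
  have [->|->] : d = horiz rho \/ d = horiz eta.
  - by move: nh; case: (horiz rho) (horiz eta) d => -[] []; auto.
  - by rewrite tr.
  - by rewrite te.
have single S (P Q : seg R) z : (forall d, seg_set (if d then P else Q) z) ->
    horiz P = true -> horiz Q = false -> S = z -> seg_set P `&` seg_set Q = [set S].
  move=> PQ hP hQ ->; apply/seteqP; split=> [u [uP uQ]|_ ->]; last first.
    by split; [exact: (PQ true)|exact: (PQ false)].
  have zP := PQ true; have zQ := PQ false.
  move: uP uQ zP zQ => /seg_setE[_ +] /seg_setE[_ +] /seg_setE[_ +] /seg_setE[_ +].
  by rewrite hP hQ => a1 a2 a3 a4; apply: (@axisP _ true); [rewrite a2 a4|rewrite a1 a3].
exfalso; apply: (no (vertex_iso v)); exists (through T true v), (through T false v); split=> //.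
- by apply/eqP => E; move: h2; rewrite E k2.
- by apply: (single _ _ _ v) => //; case.
apply: (single _ _ _ (vertex_iso v)); rewrite ?dir//.
by case; rewrite -wt; [case: (throughP redT' true wT)|case: (throughP redT' false wT)].
Qed.

Lemma consecutive_iso d v w : v \in vertices T -> w \in vertices T ->
  consecutive T d v w <-> consecutive T' d (vertex_iso v) (vertex_iso w).
Proof.
move=> vT wT; have [vT' vt] := through_vertex_iso vT.
have [wT' wt] := through_vertex_iso wT.
have thE u u' : u \in vertices T -> u' \in vertices T ->
    through T d u = through T d u' <->
    through T' d (vertex_iso u) = through T' d (vertex_iso u').
  move=> uT u'T; rewrite (through_vertex_iso uT).2 (through_vertex_iso u'T).2.
  split=> [->//|]; apply: iso_inj.
    by case: (throughP redT d uT).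
  by case: (throughP redT d u'T).
have tvw := thE v w vT wT; have avw := axis_vertex_iso_lt d vT wT.
split=> -[h1 h2 h3].
  split; [exact/tvw|exact/avw|].
  move=> _ /vertex_iso_surj[u uT <-] /(thE u v uT vT) tu /andP[h4 h5].
  by apply: (h3 u uT tu); apply/andP; split;
    [exact/(axis_vertex_iso_lt d vT uT)|exact/(axis_vertex_iso_lt d uT wT)].
split; [exact/tvw|exact/avw|].
move=> u uT /(thE u v uT vT) tu /andP[h4 h5].
apply: (h3 (vertex_iso u) (vertex_iso_vertex uT) tu).
by apply/andP; split; [exact/(axis_vertex_iso_lt d vT uT)|exact/(axis_vertex_iso_lt d uT wT)].
Qed.

Definition edge_iso e : seg R := Seg (horiz e) (axis (~~ horiz e) (vertex_iso (start e)))
  (axis (horiz e) (vertex_iso (start e))) (axis (horiz e) (vertex_iso (stop e))).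

Lemma endpoint_edge_iso i e : e \in edges T ->
  endpoint i (edge_iso e) = vertex_iso (endpoint i e).
Proof.
move=> eT; have [_ _ [st _ _]] := (edge_consecutive e meshT redT).1 eT.
case: i; rewrite /endpoint ?startE ?stopE /=; rewrite -?startE -?stopE.
  exact: pt_axis.
rewrite -[RHS](pt_axis (horiz e)); congr pt.
by rewrite !axis_vertex_iso negbK st.
Qed.

Lemma edge_iso_edge e : e \in edges T -> edge_iso e \in edges T'.
Proof.
move=> eT; apply/(edge_consecutive _ meshT' redT').
have := endpoint_edge_iso true eT; rewrite /endpoint => ->.
have := endpoint_edge_iso false eT; rewrite /endpoint => ->.
have [sT tT c] := (edge_consecutive e meshT redT).1 eT.
by split; [exact: vertex_iso_vertex|exact: vertex_iso_vertex|exact/consecutive_iso].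
Qed.

Lemma edge_iso_surj f : f \in edges T' -> exists2 e, e \in edges T & edge_iso e = f.
Proof.
move=> fT; have [sT tT c] := (edge_consecutive f meshT' redT').1 fT.
have [v vT vs] := vertex_iso_surj sT; have [w wT wt] := vertex_iso_surj tT.
rewrite -vs -wt in c; move/(consecutive_iso _ vT wT) : c => [c1 c2 c3].
pose e := Seg (horiz f) (axis (~~ horiz f) v) (axis (horiz f) v) (axis (horiz f) w).
have se : start e = v by rewrite startE /= pt_axis.
have te : stop e = w.
  rewrite stopE /= -[RHS](pt_axis (horiz f)); congr pt.
  by rewrite !(axis_through redT)// negbK c1.
have eT : e \in edges T by apply/(edge_consecutive _ meshT redT); rewrite se te.
exists e => //; apply: seg_eq => //.
  by rewrite -vs -se; exact: (endpoint_edge_iso true eT).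
by rewrite -wt -te; exact: (endpoint_edge_iso false eT).
Qed.

Lemma edge_iso_inj e f : e \in edges T -> f \in edges T ->
  edge_iso e = edge_iso f -> e = f.
Proof.
move=> eT fT ef; have := congr1 (@horiz R) ef => /= h.
have E i : endpoint i e = endpoint i f.
  apply: vertex_iso_inj; rewrite ?endpoint_vertex//.
  by rewrite -!endpoint_edge_iso// ef.
by apply: seg_eq h (E true) (E false).
Qed.

Lemma edge_iso_int e : e \in edges T ->
  (edge_iso e \in int_edges T') = (e \in int_edges T).
Proof.
move=> eT; have eT' := edge_iso_edge eT; have sT := endpoint_vertex true eT.
have [h1 h2 h3] := throughP redT (horiz e) sT.
have es := edge_sub_through meshT redT true eT.
have es' := edge_sub_through meshT' redT' true eT'.
rewrite endpoint_edge_iso// (through_vertex_iso sT).2 in es'.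
apply/idP/idP.
  move=> /(int_edge_MShat meshT' redT' (iso_MShat h1) eT' es') nb.
  by apply/(int_edge_MShat meshT redT h1 eT es) => /(iso_BMSP h1).
move=> /(int_edge_MShat meshT redT h1 eT es) nb.
by apply/(int_edge_MShat meshT' redT' (iso_MShat h1) eT' es') => /(iso_BMSP h1).
Qed.

Lemma edge_mapE e : e \in edges T -> edge_map T T' alpha e = edge_iso e.
Proof.
move=> eT; have eT' := edge_iso_edge eT; have sT := endpoint_vertex true eT.
have tT := endpoint_vertex false eT.
have [h1 h2 h3] := throughP redT (horiz e) sT.
have es := edge_sub_through meshT redT true eT.
have es' := edge_sub_through meshT' redT' true eT'.
have lt := edges_nondeg meshT' eT'.
rewrite endpoint_edge_iso// (through_vertex_iso sT).2 in es'.
have iS := endpoint_edge_iso true eT; have iT := endpoint_edge_iso false eT.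
rewrite /edge_map; case: xgetP => [f _ [fT [rho [r1 er fr]]]|no].
  have lf := edges_nondeg meshT' fT.
  have [he _ _ _] := seg_subP (edges_nondeg meshT eT) er.
  have [hf _ _ _] := seg_subP lf fr; rewrite dir// -he in hf.
  rewrite !vertex_mapE// -[vertex_iso (start e)]iS -[vertex_iso (stop e)]iT => /seteqP[E _].
  have Es : start f = start (edge_iso e) \/ start f = stop (edge_iso e) := E _ (or_introl erefl).
  have Et : stop f = start (edge_iso e) \/ stop f = stop (edge_iso e) := E _ (or_intror erefl).
  have a1 := axis_endpoint true hf; have a2 := axis_endpoint false hf.
  have eh : horiz (edge_iso e) = horiz e by [].
  have a3 := axis_endpoint true eh; have a4 := axis_endpoint false eh.
  rewrite /endpoint in a1 a2 a3 a4.
  (* The endpoint sets agree, which leaves four matchings; [lo < hi] for both edges excludes all but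
     the one that preserves order. *)
  by case: Es Et => [Es [Et|Et]|Es [Et|Et]]; rewrite Es Et in a1 a2;
    first [exact: seg_eq | exfalso; lra].
exfalso; apply: (no (edge_iso e)); split=> //.
exists (through T (horiz e) (start e)); split=> //.
by rewrite !vertex_mapE//; have -> : start (edge_iso e) = _ := iS;
  have -> : stop (edge_iso e) = _ := iT.
Qed.

(** * Invariance of incidence, interiority and the number of cells *)

Lemma has_edge_iso d i v : v \in vertices T ->
  has_edge T' d i (vertex_iso v) <-> has_edge T d i v.
Proof.
move=> vT; split=> [[_ [/edge_iso_surj[e eT <-] h ev]]|[e [eT h ev]]].
  exists e; split=> //; apply: vertex_iso_inj => //; first exact: endpoint_vertex.
  by rewrite -endpoint_edge_iso.
by exists (edge_iso e); split; rewrite ?edge_iso_edge ?endpoint_edge_iso ?ev.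
Qed.

Lemma vertex_iso_BMS d v : v \in vertices T ->
  BMS T' (through T' d (vertex_iso v)) <-> BMS T (through T d v).
Proof.
move=> vT; rewrite (through_vertex_iso vT).2; apply: iso_BMSP.
by case: (throughP redT d vT).
Qed.

Lemma vertex_iso_int v : v \in vertices T ->
  (vertex_iso v \in int_vertices T') = (v \in int_vertices T).
Proof.
move=> vT; have vT' := vertex_iso_vertex vT.
apply/idP/idP => [/(int_vertexP meshT' redT' vT') nb|/(int_vertexP meshT redT vT) nb].
  by apply/(int_vertexP meshT redT vT) => d /(vertex_iso_BMS d vT); exact: nb.
by apply/(int_vertexP meshT' redT' vT') => d /(vertex_iso_BMS d vT); exact: nb.
Qed.

Lemma num_corners_iso v : v \in vertices T ->
  num_corners T' (vertex_iso v) = num_corners T v.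
Proof.
move=> vT; rewrite /num_corners.
rewrite !(asbool_equiv_eq (vertex_iso_BMS _ vT)).
by rewrite !(asbool_equiv_eq (has_edge_iso _ _ vT)).
Qed.

Lemma seg_edge_iso e v : e \in edges T -> v \in vertices T ->
  seg_set (edge_iso e) (vertex_iso v) <-> seg_set e v.
Proof.
move=> eT vT; have eT' := edge_iso_edge eT; split=> h.
  have [k] := vertex_in_edge redT' eT' (vertex_iso_vertex vT) h.
  rewrite endpoint_edge_iso// => /vertex_iso_inj -> //; last exact: endpoint_vertex.
  exact: (seg_endpoint meshT).
have [k ->] := vertex_in_edge redT eT vT h.
rewrite -endpoint_edge_iso//; exact: (seg_endpoint meshT' _ eT').
Qed.

Lemma int_verticesW (S : premesh R) : {subset int_vertices S <= vertices S}.
Proof. by move=> v; rewrite inE => /andP[]. Qed.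

Lemma int_edgesW (S : premesh R) : {subset int_edges S <= edges S}.
Proof. by move=> e; rewrite inE => /andP[]. Qed.

Lemma perm_vertices : perm_eq [seq vertex_iso v | v <- vertices T] (vertices T').
Proof.
apply: uniq_perm => [||w]; rewrite ?fset_uniq//.
  by rewrite map_inj_in_uniq ?fset_uniq//; exact: vertex_iso_inj.
apply/mapP/idP => [[v vT ->]|/vertex_iso_surj[v vT <-]]; last by exists v.
exact: vertex_iso_vertex.
Qed.

Lemma perm_int_vertices :
  perm_eq [seq vertex_iso v | v <- int_vertices T] (int_vertices T').
Proof.
apply: uniq_perm => [||w]; rewrite ?fset_uniq//.
  rewrite map_inj_in_uniq ?fset_uniq// => v w /int_verticesW vT /int_verticesW.
  exact: vertex_iso_inj.
apply/mapP/idP => [[v vi ->]|wi]; first by rewrite vertex_iso_int// int_verticesW.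
have [v vT vw] := vertex_iso_surj (int_verticesW wi).
by exists v => //; rewrite -vertex_iso_int// vw.
Qed.

Lemma perm_int_edges : perm_eq [seq edge_iso e | e <- int_edges T] (int_edges T').
Proof.
apply: uniq_perm => [||f]; rewrite ?fset_uniq//.
  rewrite map_inj_in_uniq ?fset_uniq// => e f /int_edgesW eT /int_edgesW.
  exact: edge_iso_inj.
apply/mapP/idP => [[e ei ->]|fi]; first by rewrite edge_iso_int// int_edgesW.
have [e eT ef] := edge_iso_surj (int_edgesW fi).
by exists e => //; rewrite -edge_iso_int// ef.
Qed.

Lemma card_cells_iso : size (cells T) = size (cells T').
Proof.
apply/eqP; rewrite -(@eqn_pmul2l 4)// (card_cells meshT redT) (card_cells meshT' redT').
rewrite -(perm_big _ perm_vertices)/= big_map big_seq [X in _ == X]big_seq.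
by apply/eqP; apply: eq_bigr => v vT; rewrite num_corners_iso.
Qed.

(** * Invariance of the dimensions and of the Euler characteristic *)

Variables (m m' : nat) (r r' : seg R -> int).
Hypothesis rr' : forall e, e \in int_edges T -> r' (edge_map T T' alpha e) = r e.

Lemma smoothness_iso e : e \in int_edges T -> r' (edge_iso e) = r e.
Proof. by move=> ei; rewrite -edge_mapE ?rr'// int_edgesW. Qed.

Lemma dim_edge_ideal_iso e : e \in int_edges T ->
  \dim (edge_ideal m m' r' (edge_iso e)) = \dim (edge_ideal m m' r e).
Proof.
(* Translating by the same amount in both coordinates avoids distinguishing the direction of [e]. *)
move=> /smoothness_iso re; pose c := cor e - cor (edge_iso e).
have one s f : edge_ideal m m' s f = (\sum_(g <- [:: f] | predT g) edge_ideal m m' s g)%VS.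
  by rewrite big_seq1.
apply/eqP; rewrite eqn_leq !one; apply/andP; split.
  apply: (@dim_sum_edge_ideal _ _ _ (- c) (- c)) => f; rewrite inE => /eqP -> _.
  by exists e; rewrite inE eqxx if_same/c; split=> //; ring.
apply: (@dim_sum_edge_ideal _ _ _ c c) => f; rewrite inE => /eqP -> _.
by exists (edge_iso e); rewrite inE eqxx if_same/c; split=> //; ring.
Qed.

Lemma cor_edge_at e v : seg_set e v -> cor e = if horiz e then v.2 else v.1.
Proof. by move=> /seg_setE[_ <-]; rewrite /axis; case: (horiz e). Qed.

(** The lines of all interior edges at [v] pass through [v], so the single translation between [v]
    and its image matches all their ideals at once. *)
Lemma dim_vertex_ideal_iso v : v \in vertices T ->
  \dim (vertex_ideal m m' T' r' (vertex_iso v)) = \dim (vertex_ideal m m' T r v).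
Proof.
move=> vT; set w := vertex_iso v; apply/eqP; rewrite eqn_leq; apply/andP; split.
  apply: (@dim_sum_edge_ideal _ _ _ (w.1 - v.1) (w.2 - v.2)) => f fi /asboolP fw.
  have [e eT ef] := edge_iso_surj (int_edgesW fi); subst f.
  have ei : e \in int_edges T by rewrite -edge_iso_int.
  have ev : seg_set e v by apply/(seg_edge_iso eT vT).
  exists e; split=> //; [exact/asboolP| |by rewrite smoothness_iso].
  rewrite (cor_edge_at ev) (cor_edge_at fw) /= -/w; case: (horiz e); ring.
apply: (@dim_sum_edge_ideal _ _ _ (v.1 - w.1) (v.2 - w.2)) => e ei /asboolP ev.
have eT := int_edgesW ei.
have fw : seg_set (edge_iso e) w by apply/(seg_edge_iso eT vT).
exists (edge_iso e); split=> //; [by rewrite edge_iso_int|exact/asboolP| |exact: smoothness_iso].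
by rewrite (cor_edge_at ev) (cor_edge_at fw) /= -/w; case: (horiz e); ring.
Qed.

Lemma euler_char_iso : euler_char m m' T r = euler_char m m' T' r'.
Proof.
rewrite /euler_char !big_const_seq !count_predT card_cells_iso; congr (_ - _ + _).
  rewrite -(perm_big _ perm_int_edges)/= big_map big_seq [RHS]big_seq.
  by apply: eq_bigr => e ei; rewrite /quotient_dim dim_edge_ideal_iso.
rewrite -(perm_big _ perm_int_vertices)/= big_map big_seq [RHS]big_seq.
by apply: eq_bigr => v /int_verticesW vT; rewrite /quotient_dim dim_vertex_ideal_iso.
Qed.

End Isomorphism.

Theorem lemma3p3 (R : realType) (T : premesh R) (r : seg R -> int) (m m' : nat)
    (T1 T2 : premesh R) (r1 r2 : seg R -> int) :
  reduced_tmesh T -> smoothness T r -> constant_along_MS T r ->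
  structural_class T r (T1, r1) -> structural_class T r (T2, r2) ->
  euler_char m m' T1 r1 = euler_char m m' T2 r2.
Proof.
move=> [meshT redT] _ _ [[/= mesh1 red1] _ [alpha1 [iso1 dir1 r1E]]].
move=> [[/= mesh2 red2] _ [alpha2 [iso2 dir2 r2E]]].
rewrite -(euler_char_iso meshT redT mesh1 red1 iso1 dir1 m m' r1E).
exact: (euler_char_iso meshT redT mesh2 red2 iso2 dir2 m m' r2E).
Qed.
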